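(* Let $(X,A_1,\dots,A_n)$ satisfy condition $( * )$, let $p:X\to X/(A_1,\dots,A_n)$ be the quotient map, $a\in\bigcup_{i=1}^nA_i$ and $*=p(a)$. If $\pi_1^{top}(X,a)$ is compact and $\pi_1^{top}(X/(A_1,\dots,A_n),* )$ is Hausdorff, then $\pi_1^{top}(X/(A_1,\dots,A_n),* )$ is either a discrete topological group or uncountable.
   Context: $X/(A_1,\dots,A_n)$ denotes the quotient space of $X$ by the equivalence relation generated by identifying all points of $A_i$ with each other for each $i$. $\pi_1^{top}(Y,y)$ is $\pi_1(Y,y)$ with the quotient topology with respect to the canonical surjection from the loop space $\Omega(Y,y)$ (based loops with the compact-open topology). Condition $( * )$ on $(X,A_1,\dots,A_n)$ means one of: (i) $X$ is path connected and the $A_i$ are open subsets of $X$ whose closures are path connected; or (ii) $X$ is connected, locally path connected and first countable, and each $A_i$ is an open or closed subset of $X$, the closures $\overline{A_i}$ being path connected and pairwise disjoint. *)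

(* Defs.v *)
From Stdlib Require Import Reals List.
Open Scope R_scope.

Definition Ens (T : Type) := T -> Prop.
Definition topology (T : Type) := Ens (Ens T).

Definition is_topology {T : Type} (O : topology T) : Prop :=
  O (fun _ => True) /\
  (forall U V, O U -> O V -> O (fun x => U x /\ V x)) /\
  (forall F : Ens (Ens T), (forall U, F U -> O U) ->
     O (fun x => exists U, F U /\ U x)).

Definition continuous {A B : Type} (OA : topology A) (OB : topology B)
  (f : A -> B) : Prop :=
  forall V, OB V -> OA (fun x => V (f x)).

Definition generated_top {T : Type} (S : Ens (Ens T)) : topology T :=
  fun U => forall O : topology T, is_topology O -> (forall V, S V -> O V) -> O U.

Definition sub_top {T : Type} (O : topology T) (P : T -> Prop)
  : topology {x : T | P x} :=
  fun V => exists U, O U /\ forall x : {x : T | P x}, V x <-> U (proj1_sig x).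

Definition prod_top {A B : Type} (OA : topology A) (OB : topology B)
  : topology (A * B) :=
  generated_top (fun W => exists U V, OA U /\ OB V /\
                    forall p, W p <-> (U (fst p) /\ V (snd p))).

Definition R_top : topology R :=
  fun U => forall x, U x -> exists e, 0 < e /\ forall y, Rabs (y - x) < e -> U y.

Definition I := {t : R | 0 <= t <= 1}.
Definition I_top : topology I := sub_top R_top (fun t => 0 <= t <= 1).
Definition I0 : I := exist _ 0 (conj (Rle_refl 0) Rle_0_1).
Definition I1 : I := exist _ 1 (conj Rle_0_1 (Rle_refl 1)).

Definition compact_set {T : Type} (O : topology T) (K : Ens T) : Prop :=
  forall F : Ens (Ens T), (forall U, F U -> O U) ->
    (forall x, K x -> exists U, F U /\ U x) ->
    exists l : list (Ens T), (forall U, In U l -> F U) /\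
                             (forall x, K x -> exists U, In U l /\ U x).
Definition compact_space {T : Type} (O : topology T) : Prop :=
  compact_set O (fun _ => True).
Definition hausdorff {T : Type} (O : topology T) : Prop :=
  forall x y : T, x <> y -> exists U V, O U /\ O V /\ U x /\ V y /\
                                      forall z, ~ (U z /\ V z).
Definition discrete {T : Type} (O : topology T) : Prop := forall U : Ens T, O U.
Definition uncountable (T : Type) : Prop :=
  ~ exists f : T -> nat, forall x y, f x = f y -> x = y.

Definition closure {T : Type} (O : topology T) (S : Ens T) : Ens T :=
  fun x => forall U, O U -> U x -> exists y, U y /\ S y.
Definition closed {T : Type} (O : topology T) (S : Ens T) : Prop :=
  O (fun x => ~ S x).
Definition path_connected_set {T : Type} (O : topology T) (S : Ens T) : Prop :=
  forall x y, S x -> S y -> exists g : I -> T,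
    continuous I_top O g /\ g I0 = x /\ g I1 = y /\ forall t, S (g t).
Definition path_connected {T : Type} (O : topology T) : Prop :=
  (exists x : T, True) /\ path_connected_set O (fun _ => True).
Definition connected {T : Type} (O : topology T) : Prop :=
  (exists x : T, True) /\
  forall U V, O U -> O V -> (forall x, U x \/ V x) -> (forall x, ~ (U x /\ V x)) ->
    (forall x, ~ U x) \/ (forall x, ~ V x).
Definition locally_path_connected {T : Type} (O : topology T) : Prop :=
  forall x U, O U -> U x -> exists V, O V /\ V x /\ (forall y, V y -> U y) /\
                                    path_connected_set O V.
Definition first_countable {T : Type} (O : topology T) : Prop :=
  forall x, exists B : nat -> Ens T, (forall k, O (B k) /\ B k x) /\
    forall U, O U -> U x -> exists k, forall y, B k y -> U y.

(* Quotient of a type by a relation R (meant to be an equivalence):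
   elements are the classes R x. Quotient topology. *)
Definition Quot {T : Type} (R : T -> T -> Prop) : Type :=
  {C : Ens T | exists x, C = R x}.
Definition qmap {T : Type} (R : T -> T -> Prop) (x : T) : Quot R :=
  exist _ (R x) (ex_intro _ x eq_refl).
Definition quot_top {T : Type} (O : topology T) (R : T -> T -> Prop)
  : topology (Quot R) :=
  fun V => O (fun x => V (qmap R x)).

Definition gen_equiv {T : Type} (S : T -> T -> Prop) : T -> T -> Prop :=
  fun x y => forall E : T -> T -> Prop,
    (forall u, E u u) -> (forall u v, E u v -> E v u) ->
    (forall u v w, E u v -> E v w -> E u w) ->
    (forall u v, S u v -> E u v) -> E x y.

Definition collapse_rel {X : Type} (n : nat) (A : nat -> Ens X) : X -> X -> Prop :=
  gen_equiv (fun u v => exists i, (i < n)%nat /\ A i u /\ A i v).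
Definition collapse_top {X : Type} (OX : topology X) (n : nat) (A : nat -> Ens X)
  : topology (Quot (collapse_rel n A)) :=
  quot_top OX (collapse_rel n A).

Definition Loop {X : Type} (OX : topology X) (x : X) : Type :=
  {f : I -> X | continuous I_top OX f /\ f I0 = x /\ f I1 = x}.
Definition loop_top {X : Type} (OX : topology X) (x : X) : topology (Loop OX x) :=
  generated_top (fun W => exists K U, compact_set I_top K /\ OX U /\
     forall f : Loop OX x, W f <-> (forall t, K t -> U (proj1_sig f t))).
Definition loop_homotopic {X : Type} (OX : topology X) (x : X)
  (f g : Loop OX x) : Prop :=
  exists H : I * I -> X, continuous (prod_top I_top I_top) OX H /\
    (forall t, H (t, I0) = proj1_sig f t) /\ (forall t, H (t, I1) = proj1_sig g t) /\
    (forall s, H (I0, s) = x) /\ (forall s, H (I1, s) = x).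
Definition pi1 {X : Type} (OX : topology X) (x : X) : Type :=
  Quot (loop_homotopic OX x).
Definition pi1_top {X : Type} (OX : topology X) (x : X) : topology (pi1 OX x) :=
  quot_top (loop_top OX x) (loop_homotopic OX x).

Definition cond_star {X : Type} (OX : topology X) (n : nat) (A : nat -> Ens X) : Prop :=
  (path_connected OX /\
   forall i, (i < n)%nat -> OX (A i) /\ path_connected_set OX (closure OX (A i)))
  \/
  (connected OX /\ locally_path_connected OX /\ first_countable OX /\
   (forall i, (i < n)%nat -> (OX (A i) \/ closed OX (A i)) /\
                             path_connected_set OX (closure OX (A i))) /\
   (forall i j, (i < n)%nat -> (j < n)%nat -> i <> j ->
      forall x, ~ (closure OX (A i) x /\ closure OX (A j) x))).

(* Main.v *)
(** The projection [p] induces a continuous map from pi1 of [X] to pi1 of the quotient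
    [Y] whose image is dense: near any loop of [Y], in the compact-open topology, there
    is one homotopic to the projection of a loop of [X].  Since pi1 of [X] is compact
    and pi1 of [Y] is Hausdorff, a dense image is everything, so pi1 of [Y] is compact
    Hausdorff.  If it is also countable, it has an isolated point by Baire's theorem,
    and it is discrete because left translations are continuous bijections.

    Density is local: it suffices that, for [W] open in [Y], two points joined by a path
    in [W] are joined in [W] by a path homotopic (in [Y]) to the projection of a path of
    [X].  If [X] is locally path connected, the classes of this relation are open in
    [W], so no path leaves one.  If the [A i] are open, each becomes an open point of
    [Y], and a path can be made constant between its first and last visits to such a
    point; off these points it lifts. *)

Require Import Defs.
From Stdlib Require Import Reals List Lra Lia Classical.
From Stdlib Require Import FunctionalExtensionality PropExtensionality IndefiniteDescription.
Open Scope R_scope.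

(** * General topology *)

Lemma set_ext {T : Type} (A B : Ens T) : (forall x, A x <-> B x) -> A = B.
Proof.
  intro H; apply functional_extensionality; intro x.
  now apply propositional_extensionality.
Qed.

Lemma open_ext {T : Type} (O : topology T) (A B : Ens T) :
  (forall x, A x <-> B x) -> O A -> O B.
Proof. intros H HA; now rewrite <- (set_ext A B H). Qed.

Lemma open_of_nbhds {T : Type} (O : topology T) (HO : is_topology O) (S : Ens T) :
  (forall x, S x -> exists V, O V /\ V x /\ forall y, V y -> S y) -> O S.
Proof.
  intro H.
  apply open_ext with (fun x => exists U, (O U /\ forall y, U y -> S y) /\ U x).
  - intro x; split.
    + intros (U & (_ & HU) & Ux); auto.
    + intro Sx; destruct (H x Sx) as (V & ? & ? & ?); exists V; auto.
  - apply HO; tauto.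
Qed.

Lemma open_empty {T : Type} (O : topology T) (HO : is_topology O) :
  O (fun _ => False).
Proof. apply open_of_nbhds; tauto. Qed.

(** Covers quotient topologies, and also supplies the topology against which membership in a
    generated topology is tested. *)
Lemma preimage_topology {S T : Type} (O : topology S) (HO : is_topology O) (f : S -> T) :
  is_topology (fun V : Ens T => O (fun x => V (f x))).
Proof.
  destruct HO as (H1 & H2 & H3); repeat split; auto.
  intros F HF.
  apply open_of_nbhds; [repeat split; auto|].
  intros x (U & FU & Ux); exists (fun x => U (f x)); split; [exact (HF U FU)|eauto].
Qed.

Lemma generated_topology {T : Type} (S : Ens (Ens T)) : is_topology (generated_top S).
Proof.
  repeat split.
  - intros O HO _; apply HO.
  - intros U V HU HV O HO HS; apply HO; [now apply HU | now apply HV].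
  - intros F HF O HO HS; apply HO; intros U FU; now apply (HF U FU).
Qed.

Lemma generated_open {T : Type} (S : Ens (Ens T)) (U : Ens T) :
  S U -> generated_top S U.
Proof. intros HU O _ HS; auto. Qed.

(** The sets with open preimage form a topology containing [S], so they include every set of the
    generated one. *)
Lemma continuous_generated {A B : Type} (OA : topology A) (HA : is_topology OA)
  (S : Ens (Ens B)) (f : A -> B) :
  (forall V, S V -> OA (fun x => V (f x))) -> continuous OA (generated_top S) f.
Proof.
  intros H V HV; apply (HV (fun V => OA (fun x => V (f x)))); auto.
  now apply preimage_topology.
Qed.

(** * Equivalence relations and quotient spaces *)

Definition equivalence {T : Type} (R : T -> T -> Prop) : Prop :=
  (forall x, R x x) /\ (forall x y, R x y -> R y x) /\
  (forall x y z, R x y -> R y z -> R x z).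

Lemma qmap_eq {T : Type} (R : T -> T -> Prop) (HR : equivalence R) (x y : T) :
  qmap R x = qmap R y <-> R x y.
Proof.
  destruct HR as (Hr & Hs & Ht); split.
  - intro H; apply (f_equal (@proj1_sig _ _)) in H; simpl in H.
    rewrite H; apply Hr.
  - intro H; apply eq_sig_hprop; [intros; apply proof_irrelevance|]; simpl.
    apply set_ext; intro z; split; intro; eauto.
Qed.

Lemma qmap_surj {T : Type} (R : T -> T -> Prop) (q : Quot R) : exists x, qmap R x = q.
Proof.
  destruct q as [C [x Hx]]; exists x.
  apply eq_sig_hprop; [intros; apply proof_irrelevance|]; now symmetry.
Qed.

(** A chosen representative makes the map total; compatibility of [h] with [R] enters only when the
    map is computed on classes. *)
Definition qlift {T S : Type} {R : T -> T -> Prop} (h : T -> S) (q : Quot R) : S :=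
  h (proj1_sig (constructive_indefinite_description _ (qmap_surj R q))).

Lemma qlift_qmap {T S : Type} (R : T -> T -> Prop) (HR : equivalence R) (h : T -> S)
  (Hh : forall x y, R x y -> h x = h y) (x : T) : qlift h (qmap R x) = h x.
Proof.
  unfold qlift; destruct constructive_indefinite_description as [y Hy]; simpl.
  apply Hh; now apply qmap_eq.
Qed.

Lemma qlift_continuous {T S : Type} (R : T -> T -> Prop) (HR : equivalence R)
  (OT : topology T) (OS : topology S) (h : T -> S)
  (Hh : forall x y, R x y -> h x = h y) :
  continuous OT OS h -> continuous (quot_top OT R) OS (qlift h).
Proof.
  intros Hc V HV; apply (open_ext OT (fun x => V (h x))); [|now apply Hc].
  intro x; now rewrite qlift_qmap.
Qed.

(** * Compactness, dense images and isolated points *)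

(** A point [y] outside the image can be separated from each point of the image, hence by
    compactness some neighbourhood of [y] misses the whole image, against density. *)
Lemma compact_dense_image_surj {A B : Type} (OA : topology A) (OB : topology B)
  (HB : is_topology OB) (f : A -> B) (Hf : continuous OA OB f)
  (HA : compact_space OA) (HH : hausdorff OB)
  (Hd : forall V, OB V -> (exists y, V y) -> exists x, V (f x)) :
  forall y, exists x, f x = y.
Proof.
  intro y; apply NNPP; intro Hn.
  destruct (HA (fun U => OA U /\ exists V, OB V /\ V y /\ forall x, U x -> ~ V (f x)))
    as (l & Hl & Hcov).
  - tauto.
  - intros x _.
    destruct (HH (f x) y) as (P & V & HP & HV & Px & Vy & Hdis); [eauto|].
    exists (fun x => P (f x)); split; [split; [now apply Hf|]|easy].
    exists V; repeat split; auto; intros x' HP' HV'; exact (Hdis _ (conj HP' HV')).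
  (* The neighbourhoods of [y] attached to the finitely many members of the subcover are
     intersected. *)
  - assert (H : exists V, OB V /\ V y /\
      forall U, In U l -> forall x, U x -> ~ V (f x)).
    { clear Hcov; induction l as [|U l IH].
      - exists (fun _ => True); repeat split; [apply HB|]; now simpl.
      - destruct IH as (V & HV & Vy & H); [now intros; apply Hl; right|].
        destruct (Hl U (or_introl eq_refl)) as (_ & V' & HV' & V'y & H').
        exists (fun z => V z /\ V' z); split; [now apply HB|split; [easy|]].
        intros W [<-|HW] x Wx [Vx V'x]; [now apply (H' x)|now apply (H W HW x)]. }
    destruct H as (V & HV & Vy & H).
    destruct (Hd V HV (ex_intro _ y Vy)) as (x & Vx).
    destruct (Hcov x Logic.I) as (U & HU & Ux); exact (H U HU x Ux Vx).
Qed.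

Lemma compact_image {A B : Type} (OA : topology A) (OB : topology B)
  (f : A -> B) (Hf : continuous OA OB f) (Hs : forall y, exists x, f x = y) :
  compact_space OA -> compact_space OB.
Proof.
  intros HA F HF Hcov.
  destruct (HA (fun W => exists U, F U /\ W = (fun x => U (f x)))) as (l & Hl & Hc).
  - intros W (U & FU & ->); now apply Hf, HF.
  - intros x _; destruct (Hcov (f x) Logic.I) as (U & FU & Ux).
    exists (fun x => U (f x)); eauto.
  (* The subcover consists of preimages; open sets giving rise to them are picked along the list. *)
  - assert (H : exists l', (forall U, In U l' -> F U) /\
      forall W, In W l -> exists U, In U l' /\ W = (fun x => U (f x))).
    { clear Hc; induction l as [|W l IH].
      - exists nil; now simpl.
      - destruct IH as (l' & H1 & H2); [now intros; apply Hl; right|].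
        destruct (Hl W (or_introl eq_refl)) as (U & FU & HU).
        exists (U :: l'); split.
        + intros U' [<-|]; auto.
        + intros W' [<-|HW']; [exists U; simpl; auto|].
          destruct (H2 W' HW') as (U' & ? & ?); exists U'; simpl; auto. }
    destruct H as (l' & H1 & H2); exists l'; split; auto.
    intros y _; destruct (Hs y) as (x & <-); destruct (Hc x Logic.I) as (W & HW & Wx).
    destruct (H2 W HW) as (U & HU & ->); eauto.
Qed.

(* Baire: the open sets [V m] decrease and [V (S m)] misses a neighbourhood of
   the [m]-th point, so those neighbourhoods have no finite subcover. *)
Lemma countable_compact_hausdorff_isolated {Z : Type} (O : topology Z)
  (HO : is_topology O) (HC : compact_space O) (HH : hausdorff O)
  (f : Z -> nat) (Hf : forall x y, f x = f y -> x = y) (z : Z) :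
  exists z0, O (fun y => y = z0).
Proof.
  apply NNPP; intro Hn.
  set (nonempty_open := fun V : Ens Z => O V /\ exists y, V y).
  (* A step acts on an index paired with an open set; the implication makes it total, so that choice
     applies. *)
  assert (Hstep : forall p : nat * Ens Z, exists V', nonempty_open (snd p) ->
    nonempty_open V' /\ (forall y, V' y -> snd p y) /\
    forall w, f w = fst p -> exists Q, O Q /\ Q w /\ forall y, Q y -> ~ V' y).
  { intros [m V]; simpl.
    destruct (classic (nonempty_open V)) as [(HV & y & Vy)|H];
      [|exists V; intro; contradiction].
    destruct (classic (exists w, f w = m)) as [(w & <-)|Hm].
    (* A nonempty open [V] without a point other than [w] would be the singleton of [w], making [w]
       isolated. *)
    - assert (H : exists y, V y /\ y <> w).
      { apply NNPP; intro H; apply Hn; exists w; apply open_ext with V; auto.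
        assert (H' : forall x, V x -> x = w)
          by (intros x Vx; apply NNPP; intro; apply H; eauto).
        intro x; split; [apply H'|intros ->]; now rewrite <- (H' y Vy). }
      destruct H as (x & Vx & Hx).
      destruct (HH x w Hx) as (P & Q & HP & HQ & Px & Qw & Hd).
      exists (fun y => V y /\ P y); intros _; split; [split; [now apply HO|eauto]|].
      split; [tauto|]; intros w' Hw'; apply Hf in Hw' as ->.
      exists Q; repeat split; auto; intros u Qu [_ Pu]; exact (Hd u (conj Pu Qu)).
    - exists V; intros _; split; [split; eauto|split; auto].
      intros w Hw; exfalso; eauto. }
  destruct (functional_choice _ Hstep) as (step & Hs).
  set (V := fix V m := match m with 0%nat => fun _ => True | S m => step (m, V m) end).
  assert (HV : forall m, nonempty_open (V m)).
  { induction m as [|m IH]; [split; [apply HO|now exists z]|].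
    now apply (Hs (m, V m)). }
  assert (Hmono : forall m k y, V (k + m)%nat y -> V m y).
  { induction k as [|k IH]; intro y; simpl; auto.
    intro Hy; apply IH; revert Hy; apply (Hs (_, V (k + m)%nat)), HV. }
  destruct (HC (fun Q => O Q /\ exists m, forall y, Q y -> ~ V m y)) as (l & Hl & Hc).
  - tauto.
  - intros w _; destruct (proj2 (proj2 (Hs (f w, V (f w)) (HV _))) w eq_refl)
      as (Q & HQ & Qw & Hd).
    exists Q; split; auto; split; auto; now exists (S (f w)).
  - assert (H : exists m, forall Q, In Q l -> forall y, Q y -> ~ V m y).
    { clear Hc; induction l as [|Q l IH]; [exists 0%nat; now simpl|].
      destruct IH as (m & Hm); [now intros; apply Hl; right|].
      destruct (Hl Q (or_introl eq_refl)) as (_ & m' & Hm').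
      exists (m + m')%nat; intros Q' [<-|HQ'] y Qy Vy.
      - apply (Hm' y Qy), (Hmono m' m), Vy.
      - apply (Hm Q' HQ' y Qy), (Hmono m m'); now rewrite Nat.add_comm. }
    destruct H as (m & Hm); destruct (HV m) as (_ & y & Vy).
    destruct (Hc y Logic.I) as (Q & HQ & Qy); exact (Hm Q HQ y Qy Vy).
Qed.

(** * Paths and homotopies with real parameters *)

(* Paths and homotopies are handled as maps defined on all of [R] and [R * R];
   [clamp] transports them to and from [I]. *)
Definition cl (t : R) : R := Rmax 0 (Rmin t 1).

Lemma cl_range (t : R) : 0 <= cl t <= 1.
Proof. unfold cl, Rmax, Rmin; repeat destruct Rle_dec; lra. Qed.

Lemma cl_id (t : R) : 0 <= t <= 1 -> cl t = t.
Proof. unfold cl, Rmax, Rmin; repeat destruct Rle_dec; lra. Qed.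

Lemma cl_lipschitz (t u : R) : Rabs (cl t - cl u) <= Rabs (t - u).
Proof.
  unfold cl, Rmax, Rmin, Rabs; repeat destruct Rle_dec; repeat destruct Rcase_abs; lra.
Qed.

Definition clamp (t : R) : I := exist _ (cl t) (cl_range t).

Lemma I_eq (u v : I) : proj1_sig u = proj1_sig v -> u = v.
Proof. apply eq_sig_hprop; intros; apply proof_irrelevance. Qed.

Lemma clamp_proj (u : I) : clamp (proj1_sig u) = u.
Proof. apply I_eq; simpl; apply cl_id, (proj2_sig u). Qed.

Lemma clamp_le0 (t : R) : t <= 0 -> clamp t = I0.
Proof. intro; apply I_eq; simpl; unfold cl, Rmax, Rmin; repeat destruct Rle_dec; lra. Qed.

Lemma clamp_ge1 (t : R) : 1 <= t -> clamp t = I1.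
Proof. intro; apply I_eq; simpl; unfold cl, Rmax, Rmin; repeat destruct Rle_dec; lra. Qed.

Lemma clamp_continuous : continuous R_top I_top clamp.
Proof.
  intros V (U & HU & HV) t Vt; apply HV in Vt; destruct (HU _ Vt) as (e & He & H).
  exists e; split; auto; intros u Hu; apply HV, H; simpl.
  pose proof (cl_lipschitz u t); lra.
Qed.

Lemma proj_continuous : continuous I_top R_top (@proj1_sig R _).
Proof. intros V HV; exists V; split; [auto | easy]. Qed.

Lemma R_topology : is_topology R_top.
Proof.
  repeat split.
  - intros t _; exists 1; split; auto; lra.
  - intros U V HU HV t [Ut Vt].
    destruct (HU t Ut) as (e & He & HeU), (HV t Vt) as (e' & He' & HeV).
    exists (Rmin e e'); split; [now apply Rmin_glb_lt|].
    intros u Hu; split; [apply HeU | apply HeV]; eapply Rlt_le_trans; eauto using Rmin_l, Rmin_r.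
  - intros F HF t (U & FU & Ut); destruct (HF U FU t Ut) as (e & He & H).
    exists e; split; eauto.
Qed.

Lemma sub_topology {T : Type} (O : topology T) (HO : is_topology O) (P : T -> Prop) :
  is_topology (sub_top O P).
Proof.
  repeat split.
  - exists (fun _ => True); split; [apply HO|easy].
  - intros U V (U' & HU & EU) (V' & HV & EV); exists (fun x => U' x /\ V' x).
    split; [now apply HO|]; intro x; now rewrite EU, EV.
  - intros F HF.
    exists (fun y => exists U, (O U /\ exists V, F V /\ forall x, U (proj1_sig x) -> V x) /\ U y).
    split; [apply HO; tauto|]; intro x; split.
    + intros (V & FV & Vx); destruct (HF V FV) as (U & HU & E).
      exists U; split; [|now apply E]; split; auto; exists V; split; auto; apply E.
    + intros (U & (_ & V & FV & E) & Ux); eauto.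
Qed.

Definition I_topology : is_topology I_top := sub_topology R_top R_topology _.

Lemma ball_open (c e : R) : R_top (fun y => Rabs (y - c) < e).
Proof.
  intros y Hy; exists (e - Rabs (y - c)); split; [lra|]; intros z Hz.
  pose proof (Rabs_triang (z - y) (y - c)) as H.
  replace (z - y + (y - c)) with (z - c) in H by lra; lra.
Qed.

Lemma I_ball_open (c e : R) : I_top (fun u => Rabs (proj1_sig u - c) < e).
Proof. exact (proj_continuous _ (ball_open c e)). Qed.

(** * Jointly continuous maps of two real variables *)

(** Joint continuity tested on squares, so that composing and pasting never touch the product
    topology. *)
Definition cont2 {T : Type} (O : topology T) (H : R -> R -> T) : Prop :=
  forall V, O V -> forall t s, V (H t s) -> exists e, 0 < e /\
    forall t' s', Rabs (t' - t) < e -> Rabs (s' - s) < e -> V (H t' s').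

Lemma cont2_comp {T : Type} (O : topology T) (H : R -> R -> T) (f g : R -> R -> R) :
  cont2 O H -> cont2 R_top f -> cont2 R_top g -> cont2 O (fun t s => H (f t s) (g t s)).
Proof.
  intros HH Hf Hg V HV t s Vts.
  destruct (HH V HV _ _ Vts) as (e & He & H1).
  assert (Hc : forall x, Rabs (x - x) < e) by (intro; rewrite Rminus_diag, Rabs_R0; auto).
  destruct (Hf _ (ball_open (f t s) e) t s (Hc _)) as (e1 & He1 & H2).
  destruct (Hg _ (ball_open (g t s) e) t s (Hc _)) as (e2 & He2 & H3).
  exists (Rmin e1 e2); split; [now apply Rmin_glb_lt|]; intros t' s' Ht Hs.
  pose proof (Rmin_l e1 e2); pose proof (Rmin_r e1 e2).
  apply H1; [apply H2 | apply H3]; lra.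
Qed.

Lemma cont2_path {T : Type} (O : topology T) (g : R -> T) (f : R -> R -> R) :
  continuous R_top O g -> cont2 R_top f -> cont2 O (fun t s => g (f t s)).
Proof. intros Hg Hf V HV; apply (Hf _ (Hg V HV)). Qed.

Lemma cont2_slice {T : Type} (O : topology T) (H : R -> R -> T) (s : R) :
  cont2 O H -> continuous R_top O (fun t => H t s).
Proof.
  intros HH V HV t Vt; destruct (HH V HV t s Vt) as (e & He & H1).
  exists e; split; auto; intros u Hu; apply H1; auto.
  now rewrite Rminus_diag, Rabs_R0.
Qed.

Lemma cont2_swap {T : Type} (O : topology T) (H : R -> R -> T) :
  cont2 O H -> cont2 O (fun t s => H s t).
Proof.
  intros HH V HV t s Vts; destruct (HH V HV s t Vts) as (e & He & H1); eauto.
Qed.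

Lemma continuous_comp {A B C : Type} (OA : topology A) (OB : topology B) (OC : topology C)
  (f : A -> B) (g : B -> C) :
  continuous OA OB f -> continuous OB OC g -> continuous OA OC (fun x => g (f x)).
Proof. intros Hf Hg V HV; apply (Hf _ (Hg V HV)). Qed.

Lemma cont2_const {T : Type} (O : topology T) (x : T) : cont2 O (fun _ _ => x).
Proof. intros V _ t s Vx; exists 1; split; auto; lra. Qed.

Lemma cont2_fst : cont2 R_top (fun t _ => t).
Proof. intros V HV t s Vt; destruct (HV t Vt) as (e & He & H); eauto. Qed.

Lemma cont2_snd : cont2 R_top (fun _ s => s).
Proof. intros V HV t s Vt; destruct (HV s Vt) as (e & He & H); eauto. Qed.

Lemma cont2_R (f : R -> R -> R) :
  (forall t s e, 0 < e -> exists d, 0 < d /\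
    forall t' s', Rabs (t' - t) < d -> Rabs (s' - s) < d -> Rabs (f t' s' - f t s) < e) ->
  cont2 R_top f.
Proof.
  intros H V HV t s Vts; destruct (HV _ Vts) as (e & He & H1).
  destruct (H t s e He) as (d & Hd & H2); eauto.
Qed.

Lemma lipschitz_cont2 (f : R -> R -> R) :
  (forall a b a' b', Rabs (f a b - f a' b') <= Rabs (a - a') + Rabs (b - b')) ->
  cont2 R_top f.
Proof.
  intro H; apply cont2_R; intros t s e He; exists (e / 2); split; [lra|].
  intros t' s' Ht Hs; pose proof (H t' s' t s); lra.
Qed.

Lemma cont2_plus (f g : R -> R -> R) :
  cont2 R_top f -> cont2 R_top g -> cont2 R_top (fun t s => f t s + g t s).
Proof.
  apply (cont2_comp R_top Rplus), lipschitz_cont2; intros.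
  replace (a + b - (a' + b')) with ((a - a') + (b - b')) by lra; apply Rabs_triang.
Qed.

Lemma cont2_minus (f g : R -> R -> R) :
  cont2 R_top f -> cont2 R_top g -> cont2 R_top (fun t s => f t s - g t s).
Proof.
  apply (cont2_comp R_top Rminus), lipschitz_cont2; intros.
  replace (a - b - (a' - b')) with ((a - a') + - (b - b')) by lra.
  rewrite <- (Rabs_Ropp (b - b')); apply Rabs_triang.
Qed.

Lemma cont2_max (f g : R -> R -> R) :
  cont2 R_top f -> cont2 R_top g -> cont2 R_top (fun t s => Rmax (f t s) (g t s)).
Proof.
  apply (cont2_comp R_top Rmax), lipschitz_cont2; intros.
  unfold Rmax, Rabs; repeat destruct Rle_dec; repeat destruct Rcase_abs; lra.
Qed.

Lemma cont2_min (f g : R -> R -> R) :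
  cont2 R_top f -> cont2 R_top g -> cont2 R_top (fun t s => Rmin (f t s) (g t s)).
Proof.
  apply (cont2_comp R_top Rmin), lipschitz_cont2; intros.
  unfold Rmin, Rabs; repeat destruct Rle_dec; repeat destruct Rcase_abs; lra.
Qed.

Lemma cont2_mult (f g : R -> R -> R) :
  cont2 R_top f -> cont2 R_top g -> cont2 R_top (fun t s => f t s * g t s).
Proof.
  apply (cont2_comp R_top Rmult), cont2_R; intros a b e He.
  pose proof (Rabs_pos a) as Ha; pose proof (Rabs_pos b) as Hb.
  (* With both increments below some [d <= 1], the three terms of the expansion add up to less than
     [K * d]. *)
  set (K := 1 + Rabs a + Rabs b).
  assert (HK : 0 < e / K) by (apply Rdiv_lt_0_compat; unfold K; lra).
  exists (Rmin 1 (e / K)); split; [apply Rmin_glb_lt; lra|]; intros a' b' Ha' Hb'.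
  pose proof (Rmin_l 1 (e / K)); pose proof (Rmin_r 1 (e / K)).
  set (d := Rmin 1 (e / K)) in *.
  replace (a' * b' - a * b) with ((a' - a) * (b' - b) + (a * (b' - b) + b * (a' - a))) by lra.
  eapply Rle_lt_trans; [apply Rabs_triang|].
  eapply Rle_lt_trans; [apply Rplus_le_compat_l, Rabs_triang|].
  rewrite !Rabs_mult.
  assert (Hd : K * d <= e).
  { replace e with (K * (e / K)) by (field; unfold K; lra).
    apply Rmult_le_compat_l; [unfold K|]; lra. }
  pose proof (Rabs_pos (a' - a)); pose proof (Rabs_pos (b' - b)).
  assert (Rabs (a' - a) * Rabs (b' - b) < d) by nra.
  assert (Rabs a * Rabs (b' - b) <= Rabs a * d) by nra.
  assert (Rabs b * Rabs (a' - a) <= Rabs b * d) by nra.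
  unfold K in Hd; lra.
Qed.

Lemma cont2_cl (f : R -> R -> R) : cont2 R_top f -> cont2 R_top (fun t s => cl (f t s)).
Proof.
  intro Hf; apply cont2_max; [apply cont2_const|].
  apply cont2_min; [auto|apply cont2_const].
Qed.

Ltac cont2 :=
  repeat (apply cont2_minus || apply cont2_plus || apply cont2_mult || apply cont2_max ||
    apply cont2_min || apply cont2_cl || apply cont2_fst || apply cont2_snd || apply cont2_const).

Lemma cont_of_cont2 (f : R -> R) : cont2 R_top (fun t _ => f t) -> continuous R_top R_top f.
Proof. apply (cont2_slice R_top (fun t _ => f t) 0). Qed.

(** Each side of the line [t = c] gives a one-sided neighbourhood. On the line the smaller radius
    serves both sides; off it the radius is cut to the distance from the line. *)
Lemma cont2_paste {T : Type} (O : topology T) (c : R) (H1 H2 : R -> R -> T) :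
  cont2 O H1 -> cont2 O H2 -> (forall s, H1 c s = H2 c s) ->
  cont2 O (fun t s => if Rle_dec t c then H1 t s else H2 t s).
Proof.
  intros C1 C2 E V HV t s Vts.
  assert (L1 : t <= c -> exists e, 0 < e /\ forall t' s', t' <= c ->
    Rabs (t' - t) < e -> Rabs (s' - s) < e -> V (H1 t' s')).
  { intro Htc; destruct (Rle_dec t c); [|lra].
    destruct (C1 V HV t s Vts) as (e & He & H); exists e; auto. }
  assert (L2 : c <= t -> exists e, 0 < e /\ forall t' s', c < t' ->
    Rabs (t' - t) < e -> Rabs (s' - s) < e -> V (H2 t' s')).
  { intro Htc; assert (V (H2 t s)).
    { destruct (Rle_dec t c); [|auto].
      assert (t = c) as -> by lra; now rewrite <- E. }
    destruct (C2 V HV t s H) as (e & He & H'); exists e; auto. }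
  destruct (Rtotal_order t c) as [Htc|[Htc|Htc]].
  - destruct L1 as (e & He & H); [lra|].
    exists (Rmin e (c - t)); split; [apply Rmin_glb_lt; lra|]; intros t' s' Ht Hs.
    pose proof (Rmin_l e (c - t)); pose proof (Rmin_r e (c - t)).
    pose proof (Rle_abs (t' - t)).
    destruct (Rle_dec t' c); [apply H|]; lra.
  - destruct L1 as (e & He & H); [lra|]; destruct L2 as (e' & He' & H'); [lra|].
    exists (Rmin e e'); split; [now apply Rmin_glb_lt|]; intros t' s' Ht Hs.
    pose proof (Rmin_l e e'); pose proof (Rmin_r e e').
    destruct (Rle_dec t' c); [apply H | apply H']; lra.
  - destruct L2 as (e & He & H); [lra|].
    exists (Rmin e (t - c)); split; [apply Rmin_glb_lt; lra|]; intros t' s' Ht Hs.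
    pose proof (Rmin_l e (t - c)); pose proof (Rmin_r e (t - c)).
    pose proof (Rle_abs (- (t' - t))) as Ha; rewrite Rabs_Ropp in Ha.
    destruct (Rle_dec t' c); [|apply H]; lra.
Qed.

Lemma continuous_paste {T : Type} (O : topology T) (c : R) (g h : R -> T) :
  continuous R_top O g -> continuous R_top O h -> g c = h c ->
  continuous R_top O (fun t => if Rle_dec t c then g t else h t).
Proof.
  intros Hg Hh E.
  apply (cont2_slice O (fun t _ => if Rle_dec t c then g t else h t) 0).
  apply (cont2_paste O c (fun t _ => g t) (fun t _ => h t)); auto;
    (apply cont2_path; [auto|cont2]).
Qed.

Lemma cont2_of_prod {T : Type} (O : topology T) (H : I * I -> T) :
  continuous (prod_top I_top I_top) O H -> cont2 O (fun t s => H (clamp t, clamp s)).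
Proof.
  (* The sets [W] satisfying this square condition form a topology containing the open rectangles,
     hence the product topology. *)
  intros HH V HV; apply (HH V HV (fun W => forall t s, W (clamp t, clamp s) -> exists e, 0 < e /\
    forall t' s', Rabs (t' - t) < e -> Rabs (s' - s) < e -> W (clamp t', clamp s'))).
  - repeat split.
    + intros; exists 1; split; auto; lra.
    + intros U1 U2 H1 H2 t s [W1 W2].
      destruct (H1 t s W1) as (e1 & He1 & G1), (H2 t s W2) as (e2 & He2 & G2).
      exists (Rmin e1 e2); split; [now apply Rmin_glb_lt|]; intros t' s' Ht Hs.
      pose proof (Rmin_l e1 e2); pose proof (Rmin_r e1 e2).
      split; [apply G1 | apply G2]; lra.
    + intros F HF t s (U & FU & Uts); destruct (HF U FU t s Uts) as (e & He & G).
      exists e; split; eauto.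
  - intros U (U1 & U2 & H1 & H2 & E) t s Uts; apply E in Uts as [W1 W2]; simpl in *.
    destruct (clamp_continuous _ H1 t W1) as (e1 & He1 & G1).
    destruct (clamp_continuous _ H2 s W2) as (e2 & He2 & G2).
    exists (Rmin e1 e2); split; [now apply Rmin_glb_lt|]; intros t' s' Ht Hs.
    pose proof (Rmin_l e1 e2); pose proof (Rmin_r e1 e2).
    apply E; split; simpl; [apply G1 | apply G2]; lra.
Qed.

Lemma prod_of_cont2 {T : Type} (O : topology T) (H : R -> R -> T) :
  cont2 O H ->
  continuous (prod_top I_top I_top) O (fun p => H (proj1_sig (fst p)) (proj1_sig (snd p))).
Proof.
  intros HH V HV; apply open_of_nbhds; [apply generated_topology|].
  intros [t s] Vts; simpl in Vts; destruct (HH V HV _ _ Vts) as (e & He & G).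
  exists (fun p => Rabs (proj1_sig (fst p) - proj1_sig t) < e /\
                   Rabs (proj1_sig (snd p) - proj1_sig s) < e).
  split; [|split].
  - apply generated_open; do 2 eexists; split; [apply (I_ball_open (proj1_sig t) e)|].
    split; [apply (I_ball_open (proj1_sig s) e)|easy].
  - simpl; rewrite !Rminus_diag, Rabs_R0; auto.
  - intros [t' s'] [Ht Hs]; now apply G.
Qed.

(** * The group structure of pi1 *)

(** The loop extended to all of [R], resting at the base point outside [0, 1]. *)
Definition lp {X : Type} {OX : topology X} {x : X} (f : Loop OX x) (t : R) : X :=
  proj1_sig f (clamp t).

Section Loops.
Context {X : Type} {OX : topology X} {x : X}.

Lemma lp_continuous (f : Loop OX x) : continuous R_top OX (lp f).
Proof. apply (continuous_comp R_top I_top OX clamp); [apply clamp_continuous | apply (proj2_sig f)]. Qed.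

Lemma lp_le0 (f : Loop OX x) (t : R) : t <= 0 -> lp f t = x.
Proof. intro; unfold lp; rewrite clamp_le0 by auto; apply (proj2_sig f). Qed.

Lemma lp_ge1 (f : Loop OX x) (t : R) : 1 <= t -> lp f t = x.
Proof. intro; unfold lp; rewrite clamp_ge1 by auto; apply (proj2_sig f). Qed.

Definition mkloop (g : R -> X) (Hg : continuous R_top OX g) (H0 : g 0 = x) (H1 : g 1 = x) :
  Loop OX x :=
  exist _ (fun t => g (proj1_sig t))
    (conj (continuous_comp I_top R_top OX _ g proj_continuous Hg) (conj H0 H1)).

Lemma lp_mkloop g Hg H0 H1 t : 0 <= t <= 1 -> lp (mkloop g Hg H0 H1) t = g t.
Proof. intro; unfold lp; simpl; now rewrite cl_id. Qed.

Lemma loop_homotopic_elim (f g : Loop OX x) : loop_homotopic OX x f g ->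
  exists H, cont2 OX H /\ (forall t, H t 0 = lp f t) /\ (forall t, H t 1 = lp g t) /\
    (forall s, H 0 s = x) /\ (forall s, H 1 s = x).
Proof.
  intros (H & HC & Hf & Hg & H0 & H1); exists (fun t s => H (clamp t, clamp s)).
  rewrite (clamp_le0 0), (clamp_ge1 1) by lra.
  split; [now apply cont2_of_prod|]; repeat split; intros; unfold lp; auto.
Qed.

(** The boundary conditions are asked on the unit square only, so the formula for [H] may take any
    values outside it. *)
Lemma loop_homotopic_intro (f g : Loop OX x) (H : R -> R -> X) :
  cont2 OX H -> (forall t, 0 <= t <= 1 -> H t 0 = lp f t) ->
  (forall t, 0 <= t <= 1 -> H t 1 = lp g t) ->
  (forall s, 0 <= s <= 1 -> H 0 s = x) -> (forall s, 0 <= s <= 1 -> H 1 s = x) ->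
  loop_homotopic OX x f g.
Proof.
  intros HC Hf Hg H0 H1.
  exists (fun p => H (proj1_sig (fst p)) (proj1_sig (snd p))).
  split; [now apply prod_of_cont2|]; repeat split; intro u; simpl.
  - rewrite Hf by apply (proj2_sig u); unfold lp; now rewrite clamp_proj.
  - rewrite Hg by apply (proj2_sig u); unfold lp; now rewrite clamp_proj.
  - apply H0, (proj2_sig u).
  - apply H1, (proj2_sig u).
Qed.

(** Both loops run along the same [w], with parameters [p] and [q] that agree at the ends; the
    straight line from [p] to [q] gives the homotopy. *)
Lemma loop_homotopic_reparam (f g : Loop OX x) (w : R -> X) (p q : R -> R) :
  continuous R_top OX w -> cont2 R_top (fun t _ => p t) -> cont2 R_top (fun t _ => q t) ->
  p 0 = q 0 -> p 1 = q 1 ->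
  (forall t, 0 <= t <= 1 -> lp f t = w (p t)) ->
  (forall t, 0 <= t <= 1 -> lp g t = w (q t)) -> loop_homotopic OX x f g.
Proof.
  intros Hw Hp Hq E0 E1 Hf Hg.
  apply (loop_homotopic_intro f g (fun t s => w ((1 - s) * p t + s * q t))).
  - apply cont2_path; auto; cont2; auto.
  - intros t Ht; rewrite Hf by auto; f_equal; lra.
  - intros t Ht; rewrite Hg by auto; f_equal; lra.
  - intros s _; rewrite <- (lp_le0 f 0), Hf by lra; f_equal; rewrite E0; lra.
  - intros s _; rewrite <- (lp_ge1 f 1), Hf by lra; f_equal; rewrite E1; lra.
Qed.

Lemma loop_homotopic_equiv : equivalence (loop_homotopic OX x).
Proof.
  split; [|split].
  - intro f; apply (loop_homotopic_reparam f f (lp f) (fun t => t) (fun t => t));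
      auto using lp_continuous; cont2.
  - intros f g H; apply loop_homotopic_elim in H as (H & HC & Hf & Hg & H0 & H1).
    apply (loop_homotopic_intro g f (fun t s => H t (1 - s))); auto.
    + apply cont2_comp; auto; cont2.
    + intros t _; now rewrite Rminus_0_r.
    + intros t _; now rewrite Rminus_diag.
  - intros f g h H K.
    apply loop_homotopic_elim in H as (H & HC & Hf & Hg & H0 & H1).
    apply loop_homotopic_elim in K as (K & KC & Kg & Kh & K0 & K1).
    apply (loop_homotopic_intro f h
      (fun t s => if Rle_dec s (1/2) then H t (2 * s) else K t (2 * s - 1))).
    (* The homotopies are stacked in [s] while pasting cuts along the first variable, hence the
       swap. *)
    + apply (cont2_swap OX (fun s t => if Rle_dec s (1/2) then H t (2 * s) else K t (2 * s - 1))).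
      apply (cont2_paste OX (1/2) (fun s t => H t (2 * s)) (fun s t => K t (2 * s - 1))).
      * apply cont2_comp; auto; cont2.
      * apply cont2_comp; auto; cont2.
      * intro t; replace (2 * (1/2)) with 1 by lra; rewrite Rminus_diag, Hg; auto.
    + intros t _; destruct Rle_dec; [|lra]; now rewrite Rmult_0_r.
    + intros t _; destruct Rle_dec; [lra|]; replace (2 * 1 - 1) with 1 by lra; auto.
    + intros s _; destruct Rle_dec; auto.
    + intros s _; destruct Rle_dec; auto.
Qed.

Definition cat (f g : Loop OX x) (t : R) : X :=
  if Rle_dec t (1/2) then lp f (2 * t) else lp g (2 * t - 1).

Lemma cat_continuous (f g : Loop OX x) : continuous R_top OX (cat f g).
Proof.
  apply (continuous_paste OX (1/2) (fun t => lp f (2 * t)) (fun t => lp g (2 * t - 1))).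
  - apply (continuous_comp R_top R_top); [apply cont_of_cont2; cont2|apply lp_continuous].
  - apply (continuous_comp R_top R_top); [apply cont_of_cont2; cont2|apply lp_continuous].
  - rewrite lp_ge1, lp_le0; auto; lra.
Qed.

Lemma cat_0 (f g : Loop OX x) : cat f g 0 = x.
Proof. unfold cat; destruct Rle_dec; [apply lp_le0|]; lra. Qed.

Lemma cat_1 (f g : Loop OX x) : cat f g 1 = x.
Proof. unfold cat; destruct Rle_dec; [|apply lp_ge1]; lra. Qed.

Definition lcat (f g : Loop OX x) : Loop OX x :=
  mkloop (cat f g) (cat_continuous f g) (cat_0 f g) (cat_1 f g).

Lemma rev_continuous (f : Loop OX x) : continuous R_top OX (fun t => lp f (1 - t)).
Proof.
  apply (continuous_comp R_top R_top); [apply cont_of_cont2; cont2|apply lp_continuous].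
Qed.

Definition lrev (f : Loop OX x) : Loop OX x :=
  mkloop (fun t => lp f (1 - t)) (rev_continuous f)
    (lp_ge1 f (1 - 0) ltac:(lra)) (lp_le0 f (1 - 1) ltac:(lra)).

Definition lconst : Loop OX x :=
  mkloop (fun _ => x) (cont2_slice OX _ 0 (cont2_const OX x)) eq_refl eq_refl.

Lemma lcat_homotopic (f g h : Loop OX x) :
  loop_homotopic OX x g h -> loop_homotopic OX x (lcat f g) (lcat f h).
Proof.
  intro H; apply loop_homotopic_elim in H as (H & HC & Hg & Hh & H0 & H1).
  apply (loop_homotopic_intro _ _
    (fun t s => if Rle_dec t (1/2) then lp f (2 * t) else H (2 * t - 1) s)).
  - apply (cont2_paste OX (1/2) (fun t _ => lp f (2 * t)) (fun t s => H (2 * t - 1) s)).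
    + apply cont2_path; [apply lp_continuous|cont2].
    + apply cont2_comp; auto; cont2.
    + intro s; rewrite lp_ge1 by lra; replace (2 * (1/2) - 1) with 0 by lra; auto.
  - intros t Ht; unfold lcat; rewrite lp_mkloop by auto; unfold cat.
    destruct Rle_dec; auto.
  - intros t Ht; unfold lcat; rewrite lp_mkloop by auto; unfold cat.
    destruct Rle_dec; auto.
  - intros s _; destruct Rle_dec; [apply lp_le0|]; lra.
  - intros s _; destruct Rle_dec; [lra|]; replace (2 * 1 - 1) with 1 by lra; auto.
Qed.

Lemma lcat_const (f : Loop OX x) : loop_homotopic OX x (lcat f lconst) f.
Proof.
  apply (loop_homotopic_reparam _ _ (lp f) (fun t => Rmin (2 * t) 1) (fun t => t)).
  - apply lp_continuous.
  - cont2.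
  - cont2.
  - rewrite Rmin_left; lra.
  - rewrite Rmin_right; lra.
  - intros t Ht; unfold lcat; rewrite lp_mkloop by auto; unfold cat.
    destruct Rle_dec.
    + now rewrite Rmin_left by lra.
    + rewrite Rmin_right, (lp_ge1 f) by lra; reflexivity.
  - auto.
Qed.

(* With [w] the concatenation of [f] (on [-1, 0]) and [g] (on [0, 1]), the loop
   on the left is [w] run along the piecewise linear map 0 -> -1 -> 0 -> 1. *)
Lemma lcat_rev (f g : Loop OX x) : loop_homotopic OX x (lcat (lrev f) (lcat f g)) g.
Proof.
  apply (loop_homotopic_reparam _ _
    (fun u => if Rle_dec u 0 then lp f (u + 1) else lp g u)
    (fun t => Rmax ((0 - 2) * t) (4 * t - 3)) (fun t => t)).
  - apply (continuous_paste OX 0 (fun u => lp f (u + 1)) (lp g)).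
    + apply (continuous_comp R_top R_top); [apply cont_of_cont2; cont2|apply lp_continuous].
    + apply lp_continuous.
    + rewrite lp_ge1, lp_le0; auto; lra.
  - cont2.
  - cont2.
  - rewrite Rmax_left; lra.
  - rewrite Rmax_right; lra.
  - intros t Ht; unfold lcat at 1; rewrite lp_mkloop by auto; unfold cat.
    destruct Rle_dec.
    + unfold lrev; rewrite lp_mkloop, Rmax_left by lra.
      destruct Rle_dec; [f_equal|]; lra.
    + unfold lcat; rewrite lp_mkloop, Rmax_right by lra; unfold cat.
      repeat destruct Rle_dec; try lra; f_equal; lra.
  - intros t Ht; destruct Rle_dec; auto.
    rewrite lp_le0, lp_ge1 by lra; auto.
Qed.

(** * Left translations of pi1 and their continuity *)

(** This is the part of [K] in [1/2, 1] stretched to [0, 1]: the times at which a condition on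
    [lcat f g] over [K] constrains [g]. A cover of it pulls back to [1/2, 1], and [low] covers the
    rest of [K]. *)
Lemma compact_shrink (K : Ens I) :
  compact_set I_top K -> compact_set I_top (fun u => K (clamp ((proj1_sig u + 1) / 2))).
Proof.
  intros HK F HF Hcov.
  set (pre := fun (U : Ens I) (u : I) => U (clamp (2 * proj1_sig u - 1))).
  assert (Hpre : continuous I_top I_top (fun u => clamp (2 * proj1_sig u - 1))).
  { apply (continuous_comp I_top R_top I_top _ (fun t => clamp (2 * t - 1)) proj_continuous).
    apply (continuous_comp R_top R_top); [apply cont_of_cont2; cont2|apply clamp_continuous]. }
  set (low := fun u : I => proj1_sig u < 1/2).
  destruct (HK (fun W => W = low \/ exists U, F U /\ W = pre U)) as (l & Hl & Hc).
  - intros W [->|(U & FU & ->)].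
    + exists (fun t => t < 1/2); split; [|easy]; intros t Ht.
      exists (1/2 - t); split; [lra|]; intros u Hu; pose proof (Rle_abs (u - t)); lra.
    + apply Hpre, HF, FU.
  - intros u Ku; destruct (Rlt_dec (proj1_sig u) (1/2)) as [Hu|Hu]; [exists low; auto|].
    destruct (Hcov (clamp (2 * proj1_sig u - 1))) as (U & FU & Uu).
    + pose proof (proj2_sig u) as Hu'; simpl in Hu' |- *; rewrite cl_id by lra.
      replace ((2 * proj1_sig u - 1 + 1) / 2) with (proj1_sig u) by field.
      now rewrite clamp_proj.
    + exists (pre U); split; [eauto|exact Uu].
  - assert (H : exists l', (forall U, In U l' -> F U) /\
      forall W, In W l -> W = low \/ exists U, In U l' /\ W = pre U).
    { clear Hc; induction l as [|W l IH].
      - exists nil; now simpl.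
      - destruct IH as (l' & H1 & H2); [now intros; apply Hl; right|].
        destruct (Hl W (or_introl eq_refl)) as [HW|(U & FU & HU)].
        + exists l'; split; auto; intros W' [<-|HW']; auto.
        + exists (U :: l'); split.
          * intros U' [<-|]; auto.
          * intros W' [<-|HW']; [right; exists U; simpl; auto|].
            destruct (H2 W' HW') as [|(U' & ? & ?)]; auto; right; exists U'; simpl; auto. }
    destruct H as (l' & H1 & H2); exists l'; split; auto; intros u Ku.
    pose proof (proj2_sig u) as Hu; simpl in Hu.
    destruct (Hc _ Ku) as (W & HW & Wu).
    destruct (H2 W HW) as [->|(U & HU & ->)].
    + unfold low in Wu; simpl in Wu; rewrite cl_id in Wu; lra.
    + exists U; split; auto; unfold pre in Wu; simpl in Wu; rewrite cl_id in Wu by lra.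
      replace (2 * ((proj1_sig u + 1) / 2) - 1) with (proj1_sig u) in Wu by field.
      now rewrite clamp_proj in Wu.
Qed.

Lemma lcat_continuous (f : Loop OX x) :
  continuous (loop_top OX x) (loop_top OX x) (lcat f).
Proof.
  apply continuous_generated; [apply generated_topology|].
  intros W (K & U & HK & HU & E).
  (* The condition on the first half does not involve [g]: if it holds, the preimage is a subbasic
     set; if it fails, the preimage is empty. *)
  destruct (classic (forall u, K u -> proj1_sig u <= 1/2 -> U (lp f (2 * proj1_sig u))))
    as [Hf|Hf].
  - apply generated_open; do 2 eexists; split; [apply (compact_shrink K HK)|].
    split; [apply HU|]; intro g; rewrite E; split.
    + intros H u Ku; specialize (H _ Ku); simpl in H; unfold cat in H.
      pose proof (proj2_sig u) as Hu; simpl in Hu; rewrite cl_id in H by lra.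
      destruct Rle_dec as [Hle|_].
      (* [cat] assigns the time 1/2 to [f]; there [f] ends and [g] starts at the same point [x]. *)
      * assert (Hu0 : proj1_sig u = 0) by lra.
        rewrite Hu0, lp_ge1 in H by lra.
        now rewrite <- (clamp_proj u), Hu0, clamp_le0, (proj1 (proj2 (proj2_sig g))) by lra.
      * unfold lp in H.
        replace (2 * ((proj1_sig u + 1) / 2) - 1) with (proj1_sig u) in H by field.
        now rewrite clamp_proj in H.
    + intros H u Ku; simpl; unfold cat; destruct Rle_dec as [Hle|Hgt]; auto.
      pose proof (proj2_sig u) as Hu; simpl in Hu.
      apply H; simpl; rewrite cl_id by lra.
      replace ((2 * proj1_sig u - 1 + 1) / 2) with (proj1_sig u) by field.
      now rewrite clamp_proj.
  - apply open_ext with (fun _ => False); [|apply open_empty, generated_topology].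
    intro g; split; [tauto|]; rewrite E; intro H; apply Hf; intros u Ku Hu.
    specialize (H u Ku); simpl in H; unfold cat in H; destruct Rle_dec; tauto.
Qed.

Lemma loop_topology : is_topology (loop_top OX x).
Proof. apply generated_topology. Qed.

Lemma pi1_topology : is_topology (pi1_top OX x).
Proof. apply (preimage_topology (loop_top OX x) loop_topology). Qed.

Lemma qmap_lcat (f g h : Loop OX x) : loop_homotopic OX x g h ->
  qmap (loop_homotopic OX x) (lcat f g) = qmap (loop_homotopic OX x) (lcat f h).
Proof.
  intro H; apply (qmap_eq _ loop_homotopic_equiv); now apply lcat_homotopic.
Qed.

Definition ltrans (f : Loop OX x) : pi1 OX x -> pi1 OX x :=
  qlift (fun g => qmap (loop_homotopic OX x) (lcat f g)).

Lemma ltrans_qmap (f g : Loop OX x) :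
  ltrans f (qmap _ g) = qmap (loop_homotopic OX x) (lcat f g).
Proof.
  exact (qlift_qmap _ loop_homotopic_equiv _ (qmap_lcat f) g).
Qed.

Lemma ltrans_continuous (f : Loop OX x) :
  continuous (pi1_top OX x) (pi1_top OX x) (ltrans f).
Proof.
  apply (qlift_continuous _ loop_homotopic_equiv).
  - apply qmap_lcat.
  - intros V HV; apply (lcat_continuous f _ HV).
Qed.

Lemma ltrans_inj (f : Loop OX x) (z w : pi1 OX x) : ltrans f z = ltrans f w -> z = w.
Proof.
  assert (H : forall z, ltrans (lrev f) (ltrans f z) = z).
  { intro q; destruct (qmap_surj _ q) as (g & <-); rewrite !ltrans_qmap.
    apply qmap_eq; [apply loop_homotopic_equiv|apply lcat_rev]. }
  intro E; now rewrite <- (H z), <- (H w), E.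
Qed.

(** Preimages of points under injective translations have at most one element. Translation by a loop
    of class [z] carries [e] to [z], so [e] is isolated; translation by the reverse of a loop of
    class [w] carries [w] to [e], so [w] is isolated too. *)
Lemma pi1_discrete_of_isolated (z : pi1 OX x) :
  pi1_top OX x (fun w => w = z) -> discrete (pi1_top OX x).
Proof.
  intro Hz.
  set (e := qmap (loop_homotopic OX x) lconst).
  assert (Hu : forall f, ltrans f e = qmap _ f).
  { intro f; unfold e; rewrite ltrans_qmap.
    apply qmap_eq; [apply loop_homotopic_equiv|apply lcat_const]. }
  assert (He : pi1_top OX x (fun w => w = e)).
  { destruct (qmap_surj _ z) as (f & <-).
    eapply open_ext; [|exact (ltrans_continuous f _ Hz)]; intro w; simpl.
    rewrite <- Hu; split; [apply ltrans_inj|now intros ->]. }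
  intro U; apply open_of_nbhds; [apply pi1_topology|]; intros w Uw.
  exists (fun v => v = w); split; [|split; [auto|now intros y ->]].
  destruct (qmap_surj _ w) as (f & <-).
  assert (Hf : ltrans (lrev f) (qmap _ f) = e).
  { rewrite <- (Hu f); unfold e; rewrite !ltrans_qmap.
    apply qmap_eq; [apply loop_homotopic_equiv|apply lcat_rev]. }
  eapply open_ext; [|exact (ltrans_continuous (lrev f) _ He)]; intro v; simpl.
  rewrite <- Hf; split; [apply ltrans_inj|now intros ->].
Qed.

End Loops.

(** * Neighbourhoods of loops *)

(** For [u] outside [K], the sets of points farther than [e > 0] from [u] cover [K]; the least
    radius in a finite subcover gives a ball around [u] that misses [K]. *)
Lemma compact_I_closed (K : Ens I) : compact_set I_top K -> closed I_top K.
Proof.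
  intro HK; unfold closed; apply open_of_nbhds; [apply I_topology|]; intros u Hu.
  destruct (HK (fun W => exists e, 0 < e /\ W = fun v => e < Rabs (proj1_sig v - proj1_sig u)))
    as (l & Hl & Hc).
  - intros W (e & He & ->); exists (fun y => e < Rabs (y - proj1_sig u)); split; [|easy].
    intros y Hy; exists (Rabs (y - proj1_sig u) - e); split; [lra|]; intros z Hz.
    pose proof (Rabs_triang (y - z) (z - proj1_sig u)) as H.
    replace (y - z + (z - proj1_sig u)) with (y - proj1_sig u) in H by lra.
    rewrite Rabs_minus_sym in Hz; lra.
  - intros v Kv.
    assert (Hv : 0 < Rabs (proj1_sig v - proj1_sig u)).
    { apply Rabs_pos_lt; intro H; apply Hu; replace u with v; auto; apply I_eq; lra. }
    exists (fun v' => Rabs (proj1_sig v - proj1_sig u) / 2 < Rabs (proj1_sig v' - proj1_sig u)).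
    split; [|lra]; eexists; split; [|reflexivity]; lra.
  - assert (H : exists e, 0 < e /\
      forall W, In W l -> forall v, W v -> e < Rabs (proj1_sig v - proj1_sig u)).
    { clear Hc; induction l as [|W l IH]; [exists 1; split; [lra|now simpl]|].
      destruct IH as (e & He & H); [now intros; apply Hl; right|].
      destruct (Hl W (or_introl eq_refl)) as (e' & He' & EW).
      exists (Rmin e e'); split; [now apply Rmin_glb_lt|].
      pose proof (Rmin_l e e'); pose proof (Rmin_r e e').
      intros W' [<-|HW'] v Wv; [subst W; lra|]; specialize (H W' HW' v Wv); lra. }
    destruct H as (e & He & H).
    exists (fun v => Rabs (proj1_sig v - proj1_sig u) < e); split; [apply I_ball_open|].
    split; [now rewrite Rminus_diag, Rabs_R0|]; intros v Hv Kv.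
    destruct (Hc v Kv) as (W & HW & Wv); specialize (H W HW v Wv); lra.
Qed.

(** The list encodes a finite intersection of subbasic sets. The sets [W] with this property form a
    topology containing the subbasis. *)
Lemma loop_top_basis {X : Type} (OX : topology X) (x : X) (W : Ens (Loop OX x))
  (f : Loop OX x) : loop_top OX x W -> W f ->
  exists l : list (Ens I * Ens X),
    (forall q, In q l -> compact_set I_top (fst q) /\ OX (snd q) /\
       forall t, fst q t -> snd q (proj1_sig f t)) /\
    (forall g : Loop OX x,
       (forall q, In q l -> forall t, fst q t -> snd q (proj1_sig g t)) -> W g).
Proof.
  intro HW; revert f; apply (HW (fun W => forall f, W f -> exists l : list (Ens I * Ens X), _ /\ _)).
  - repeat split.
    + intros f _; exists nil; split; [now simpl|easy].
    + intros U V HU HV f [Uf Vf].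
      destruct (HU f Uf) as (l & H1 & H2), (HV f Vf) as (l' & H1' & H2').
      exists (l ++ l'); split.
      * intros q Hq; apply in_app_or in Hq as [|]; auto.
      * intros g Hg; split; [apply H2|apply H2']; intros q Hq; apply Hg, in_or_app; auto.
    + intros F HF f (U & FU & Uf); destruct (HF U FU f Uf) as (l & H1 & H2).
      exists l; split; auto; intros g Hg; exists U; auto.
  - intros V (K & U & HK & HU & E) f Vf; exists ((K, U) :: nil); split.
    + intros q [<-|[]]; simpl; split; auto; split; auto; now apply E.
    + intros g Hg; apply E; exact (Hg (K, U) (or_introl eq_refl)).
Qed.

(** Near the time [s] the finitely many compact-open conditions reduce to one open set: a pair
    [(K, U)] contributes [U] if [s] is in [K], and otherwise nothing, since nearby times avoid the
    closed set [K]. *)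
Lemma loop_basis_local {X : Type} (OX : topology X) (HX : is_topology OX) (x : X)
  (f : Loop OX x) (l : list (Ens I * Ens X)) (s : R) :
  (forall q, In q l -> compact_set I_top (fst q) /\ OX (snd q) /\
     forall t, fst q t -> snd q (proj1_sig f t)) ->
  exists e W, 0 < e /\ OX W /\ (forall t, Rabs (t - s) < e -> W (lp f t)) /\
    forall t, Rabs (t - s) < e -> forall y, W y ->
      forall q, In q l -> fst q (clamp t) -> snd q y.
Proof.
  induction l as [|[K U] l IH]; intro Hl.
  - exists 1, (fun _ => True); split; [lra|]; split; [apply HX|]; now simpl.
  - destruct IH as (e & W & He & HW & H1 & H2); [now intros; apply Hl; right|].
    destruct (Hl (K, U) (or_introl eq_refl)) as (HK & HU & Hf); simpl in *.
    destruct (classic (K (clamp s))) as [Ks|Ks].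
    + destruct (lp_continuous f U HU s (Hf _ Ks)) as (e' & He' & H').
      exists (Rmin e e'), (fun y => W y /\ U y).
      pose proof (Rmin_l e e'); pose proof (Rmin_r e e').
      split; [now apply Rmin_glb_lt|]; split; [now apply HX|]; split.
      * intros t Ht; split; [apply H1|apply H']; lra.
      * intros t Ht y [Wy Uy] q [<-|Hq]; simpl; auto; apply (H2 t); auto; lra.
    + destruct (clamp_continuous _ (compact_I_closed K HK) s Ks) as (e' & He' & H').
      exists (Rmin e e'), W.
      pose proof (Rmin_l e e'); pose proof (Rmin_r e e').
      split; [now apply Rmin_glb_lt|]; split; [easy|]; split.
      * intros t Ht; apply H1; lra.
      * intros t Ht y Wy q [<-|Hq]; simpl; [|apply (H2 t); auto; lra].
        intro Kt; exfalso; apply (H' t); auto; lra.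
Qed.

(** A form of Cousin's lemma, used in place of subdivisions: the supremum [m] of the [t] with
    [Q c t] must be [d], since local validity around [m] would otherwise extend the property past
    [m]. *)
Lemma cousin (Q : R -> R -> Prop) (c d : R) : c < d ->
  (forall a b e, a < b -> b < e -> Q a b -> Q b e -> Q a e) ->
  (forall s, c <= s <= d -> exists r, 0 < r /\
     forall a b, c <= a -> a <= s -> s <= b -> b <= d -> a < b ->
       s - r < a -> b < s + r -> Q a b) ->
  Q c d.
Proof.
  intros Hcd Htr Hloc.
  set (E := fun t => c < t <= d /\ Q c t).
  destruct (Hloc c) as (r0 & Hr0 & H0); [lra|].
  pose proof (Rmin_l d (c + r0 / 2)); pose proof (Rmin_r d (c + r0 / 2)).
  assert (HE0 : E (Rmin d (c + r0 / 2))).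
  { assert (c < Rmin d (c + r0 / 2)) by (apply Rmin_glb_lt; lra).
    split; [lra|]; apply H0; lra. }
  destruct (completeness E) as (m & Hub & Hlub).
  - exists d; intros t [Ht _]; lra.
  - eauto.
  - assert (Hm : c <= m <= d).
    { pose proof (Hub _ HE0) as Hm0; destruct HE0 as [[Hm1 _] _]; split; [lra|].
      apply Hlub; intros t [Ht _]; lra. }
    destruct (Hloc m Hm) as (r & Hr & HQ).
    assert (Ht : exists t, E t /\ m - r < t).
    { apply NNPP; intro Hn; enough (m <= m - r) by lra; apply Hlub; intros t Et.
      apply Rnot_lt_le; intro; apply Hn; eauto. }
    destruct Ht as (t & Et & Hrt); pose proof (Hub t Et) as Htm; destruct Et as [Hct Qt].
    (* [Q c t] and [Q t b] give [Q c b], so [b <= m]; this excludes [b = m + r / 2] and leaves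
       [b = d]. *)
    set (b := Rmin d (m + r / 2)).
    assert (Hb1 : b <= d) by apply Rmin_l; assert (Hb2 : b <= m + r / 2) by apply Rmin_r.
    assert (Hb3 : m <= b) by (apply Rmin_glb; lra).
    assert (Qb : Q c b).
    { destruct (Rle_lt_or_eq_dec t b) as [Htb|<-]; [lra| |auto].
      apply Htr with t; [lra|lra|auto|apply HQ; lra]. }
    assert (Eb : E b) by (split; auto; lra).
    pose proof (Hub b Eb).
    assert (Hb : b = d \/ b = m + r / 2) by (unfold b, Rmin; destruct Rle_dec; auto).
    destruct Hb as [Hb|]; [now rewrite <- Hb|lra].
Qed.

(** Closure commutes with finite unions, here of the [A j] with [P j]: if a neighbourhood [V] of [x]
    misses the earlier sets, every neighbourhood of [x] meets the last one inside [V]. *)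
Lemma closure_finite_union {X : Type} (OX : topology X) (HX : is_topology OX)
  (A : nat -> Ens X) (P : nat -> Prop) (x : X) (n : nat) :
  (forall V, OX V -> V x -> exists j y, (j < n)%nat /\ P j /\ A j y /\ V y) ->
  exists j, (j < n)%nat /\ P j /\ closure OX (A j) x.
Proof.
  induction n as [|n IH]; intro H.
  - destruct (H (fun _ => True)) as (j & y & Hj & _); [apply HX|easy|lia].
  - destruct (classic (P n /\ closure OX (A n) x)) as [[HP Hx]|Hn]; [exists n; auto|].
    destruct IH as (j & Hj & HP); [|exists j; split; [lia|auto]].
    intros V HV Vx; apply NNPP; intro Hno; apply Hn.
    assert (HPn : forall U, OX U -> U x -> P n /\ exists y, U y /\ A n y).
    { intros U HU Ux; destruct (H (fun y => U y /\ V y)) as (j & y & Hj & HP & Ay & Uy & Vy);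
        [now apply HX|easy|].
      destruct (Nat.eq_dec j n) as [->|]; [eauto|].
      exfalso; apply Hno; exists j, y; repeat split; auto; lia. }
    split; [apply (HPn V HV Vx)|]; intros U HU Ux; apply (HPn U HU Ux).
Qed.

(** * Paths in the quotient that lift up to homotopy *)

Section Collapse.
Context {X : Type} (OX : topology X) (HX : is_topology OX) (n : nat) (A : nat -> Ens X).
Let p : X -> Quot (collapse_rel n A) := qmap (collapse_rel n A).
Let OY : topology (Quot (collapse_rel n A)) := collapse_top OX n A.

Lemma collapse_equiv : equivalence (collapse_rel n A).
Proof.
  split; [|split].
  - intros x E Hr _ _ _; apply Hr.
  - intros x y H E Hr Hs Ht HS; apply Hs; now apply H.
  - intros x y z H K E Hr Hs Ht HS; apply Ht with y; [now apply H | now apply K].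
Qed.

Lemma collapse_eq (x y : X) : p x = p y <-> collapse_rel n A x y.
Proof. apply (qmap_eq _ collapse_equiv). Qed.

Lemma collapse_in (i : nat) (x y : X) : (i < n)%nat -> A i x -> A i y -> p x = p y.
Proof. intros Hi Hx Hy; apply collapse_eq; intros E _ _ _ H; eauto. Qed.

(** The disjunction is an equivalence relation containing the generating pairs. The two indices may
    differ, as overlapping sets are collapsed to one point. *)
Lemma collapse_cases (x y : X) : p x = p y ->
  x = y \/ ((exists i, (i < n)%nat /\ A i x) /\ (exists i, (i < n)%nat /\ A i y)).
Proof.
  intro H; apply collapse_eq in H; apply H; clear.
  - auto.
  - intros u v [->|[? ?]]; auto.
  - intros u v w [->|[? ?]] [->|[? ?]]; auto.
  - intros u v (i & Hi & Hu & Hv); right; split; eauto.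
Qed.

Lemma collapse_topology : is_topology OY.
Proof. exact (preimage_topology OX HX p). Qed.

Lemma p_continuous : continuous OX OY p.
Proof. intros V HV; exact HV. Qed.

(* [H] deforms the projection of a path in [X], relative to its end points,
   into a path which lies in [U t] at every time [t]. *)
Definition Joined (c d : R) (U : R -> Ens (Quot (collapse_rel n A))) (x y : X) : Prop :=
  exists (g : R -> X) (H : R -> R -> Quot (collapse_rel n A)),
    continuous R_top OX g /\ cont2 OY H /\ g c = x /\ g d = y /\
    (forall t, H t 0 = p (g t)) /\ (forall s, H c s = p x) /\ (forall s, H d s = p y) /\
    forall t, c <= t <= d -> U t (H t 1).

Lemma joined_trans c m d U x y z : c < m -> m < d ->
  Joined c m U x y -> Joined m d U y z -> Joined c d U x z.
Proof.
  intros Hcm Hmd (g & H & Cg & CH & gc & gm & H0 & Hc & Hm & HU)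
    (g' & H' & Cg' & CH' & gm' & gd & H0' & Hm' & Hd & HU').
  exists (fun t => if Rle_dec t m then g t else g' t),
         (fun t s => if Rle_dec t m then H t s else H' t s).
  split; [apply continuous_paste; auto; congruence|].
  split; [apply cont2_paste; auto; intro s; now rewrite Hm, Hm'|].
  split; [destruct Rle_dec; [auto|lra]|].
  split; [destruct Rle_dec; [lra|auto]|].
  split; [intro t; destruct Rle_dec; auto|].
  split; [intro s; destruct Rle_dec; [auto|lra]|].
  split; [intro s; destruct Rle_dec; [lra|auto]|].
  intros t Ht; destruct Rle_dec; [apply HU | apply HU']; lra.
Qed.

Lemma joined_mono c d U V x y :
  (forall t, c <= t <= d -> forall q, U t q -> V t q) ->
  Joined c d U x y -> Joined c d V x y.
Proof.
  intros HUV (g & H & Cg & CH & gc & gm & H0 & Hc & Hm & HU).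
  exists g, H; repeat split; auto.
Qed.

Lemma joined_rescale c d c' d' U x y : c < d -> c' < d' ->
  Joined c d (fun _ => U) x y -> Joined c' d' (fun _ => U) x y.
Proof.
  intros Hcd Hcd' (g & H & Cg & CH & gc & gd & H0 & Hc & Hd & HU).
  set (r := (d - c) / (d' - c')).
  assert (Hr : 0 < r) by (apply Rdiv_lt_0_compat; lra).
  assert (Er : r * (d' - c') = d - c) by (unfold r; field; lra).
  assert (E0 : c + r * (c' - c') = c) by ring.
  assert (E1 : c + r * (d' - c') = d) by lra.
  exists (fun t => g (c + r * (t - c'))), (fun t s => H (c + r * (t - c')) s).
  split; [apply (continuous_comp R_top R_top); auto; apply cont_of_cont2; cont2|].
  split; [apply cont2_comp; auto; cont2|].
  rewrite E0, E1; repeat split; auto.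
  intros t Ht; apply HU; nra.
Qed.

Lemma joined_rev c d U x y : c < d ->
  Joined c d (fun _ => U) x y -> Joined c d (fun _ => U) y x.
Proof.
  intros Hcd (g & H & Cg & CH & gc & gd & H0 & Hc & Hd & HU).
  exists (fun t => g (c + d - t)), (fun t s => H (c + d - t) s).
  replace (c + d - c) with d by lra; replace (c + d - d) with c by lra.
  split; [apply (continuous_comp R_top R_top); auto; apply cont_of_cont2; cont2|].
  split; [apply cont2_comp; auto; cont2|].
  repeat split; auto; intros t Ht; apply HU; lra.
Qed.

Lemma joined_path c d U (g : R -> X) : continuous R_top OX g ->
  (forall t, c <= t <= d -> U t (p (g t))) -> Joined c d U (g c) (g d).
Proof.
  intros Cg HU; exists g, (fun t _ => p (g t)).
  split; auto; split; [|repeat split; auto].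
  apply (cont2_path OY (fun t => p (g t)) (fun t _ => t)); [|cont2].
  exact (continuous_comp R_top OX OY g p Cg p_continuous).
Qed.

Lemma joined_refl (W : Ens (Quot (collapse_rel n A))) x :
  W (p x) -> Joined 0 1 (fun _ => W) x x.
Proof.
  intro Wx; apply (joined_path 0 1 (fun _ => W) (fun _ => x)); auto.
  exact (cont2_slice OX _ 0 (cont2_const OX x)).
Qed.

Lemma joined_trans01 (W : Ens (Quot (collapse_rel n A))) x y z :
  Joined 0 1 (fun _ => W) x y -> Joined 0 1 (fun _ => W) y z -> Joined 0 1 (fun _ => W) x z.
Proof.
  intros H1 H2; apply joined_trans with (1/2) y; try lra;
    apply joined_rescale with 0 1; auto; lra.
Qed.

Lemma joined_of_path_connected (S : Ens X) (W : Ens (Quot (collapse_rel n A))) x y :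
  path_connected_set OX S -> (forall z, S z -> W (p z)) -> S x -> S y ->
  Joined 0 1 (fun _ => W) x y.
Proof.
  intros HS HW Sx Sy; destruct (HS x y Sx Sy) as (g & Cg & <- & <- & Sg).
  rewrite <- (clamp_le0 0), <- (clamp_ge1 1) by lra.
  apply (joined_path 0 1 (fun _ => W) (fun t => g (clamp t))); auto.
  exact (continuous_comp R_top I_top OX clamp g clamp_continuous Cg).
Qed.

Context (Hcl : forall i, (i < n)%nat -> path_connected_set OX (closure OX (A i))).

(* The path in [closure OX (A i)] projects into the closure of the point [p v],
   so it can be deformed at once into the path that jumps from [p x] to [p v]. *)
Lemma joined_closure (i : nat) (W : Ens (Quot (collapse_rel n A))) x v :
  (i < n)%nat -> closure OX (A i) x -> A i v -> W (p x) -> W (p v) ->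
  Joined 0 1 (fun _ => W) x v.
Proof.
  intros Hi Hx Hv Wx Wv.
  assert (Hv' : closure OX (A i) v) by (intros U _ Uv; eauto).
  destruct (Hcl i Hi x v Hx Hv') as (g & Cg & g0 & g1 & Hg).
  (* The preimage of [V] is a neighbourhood of [g t], so it meets [A i], all of which projects to
     [p v]. *)
  assert (Hg' : forall V t, OY V -> V (p (g t)) -> V (p v)).
  { intros V t HV Vt; destruct (Hg t _ HV Vt) as (y & Vy & Ay).
    now rewrite (collapse_in i v y). }
  assert (Cc : continuous R_top OX (fun t => g (clamp t)))
    by exact (continuous_comp R_top I_top OX clamp g clamp_continuous Cg).
  exists (fun t => g (clamp t)),
    (fun t s => if Rle_dec (Rmin t s) 0 then p (g (clamp t)) else p v).
  split; [exact Cc|]; split.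
  - intros V HV t s Vts.
    assert (Vv : V (p v)) by (destruct (Rle_dec (Rmin t s) 0); [exact (Hg' V (clamp t) HV Vts)|auto]).
    destruct (Rle_dec (Rmin t s) 0) as [Hle|Hgt].
    + destruct (continuous_comp R_top OX OY _ p Cc p_continuous V HV t Vts) as (e & He & H).
      exists e; split; auto; intros t' s' Ht _; destruct Rle_dec; auto.
    + exists (Rmin t s); split; [lra|]; intros t' s' Ht Hs.
      pose proof (Rmin_l t s); pose proof (Rmin_r t s).
      pose proof (Rle_abs (- (t' - t))) as Ha; rewrite Rabs_Ropp in Ha.
      pose proof (Rle_abs (- (s' - s))) as Hb; rewrite Rabs_Ropp in Hb.
      destruct Rle_dec as [Hle'|]; auto; exfalso.
      revert Hle'; unfold Rmin at 1; destruct Rle_dec; lra.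
  - rewrite (clamp_le0 0), (clamp_ge1 1) by lra; split; auto; split; auto.
    split; [|split; [|split]].
    + intro t; destruct Rle_dec as [|H]; auto; destruct H; apply Rmin_r.
    + intro s; destruct Rle_dec as [|H]; [congruence|]; destruct H; apply Rmin_l.
    + intro s; destruct Rle_dec; congruence.
    + intros t Ht; destruct Rle_dec as [H|]; auto.
      replace t with 0; [now rewrite clamp_le0, g0 by lra|].
      revert H; unfold Rmin; destruct Rle_dec; lra.
Qed.

(** Lets the representative of a point of the quotient be changed inside [W]; generating pairs are
    handled by [joined_closure]. *)
Lemma joined_fibre (W : Ens (Quot (collapse_rel n A))) x y :
  p x = p y -> W (p x) -> Joined 0 1 (fun _ => W) x y.
Proof.
  intro H; apply collapse_eq in H; revert W.
  (* The equality is carried along the induction to move the hypothesis [W (p x)] to other points of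
     the fibre. *)
  enough (G : p x = p y /\ forall W : Ens (Quot (collapse_rel n A)),
    W (p x) -> Joined 0 1 (fun _ => W) x y) by apply G.
  apply (H (fun x y => p x = p y /\ forall W : Ens (Quot (collapse_rel n A)),
    W (p x) -> Joined 0 1 (fun _ => W) x y)); clear x y H.
  - intro u; split; auto; intros; now apply joined_refl.
  - intros u v [E H]; split; auto; intros W Wv; apply joined_rev; [lra|].
    apply H; now rewrite E.
  - intros u v w [E H] [E' H']; split; [congruence|]; intros W Wu.
    apply joined_trans01 with v; auto; apply H'; now rewrite <- E.
  - intros u v (i & Hi & Hu & Hv); split; [now apply (collapse_in i)|].
    intros W Wu; apply (joined_closure i); auto.
    + intros U _ Uu; eauto.
    + now rewrite (collapse_in i v u).
Qed.

(** * Local joining, for locally path connected spaces and for open sets *)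

(** The joining path need not be homotopic to [f]: density asks for a loop near the given one, not
    in its class. *)
Definition local_joining : Prop :=
  forall (W : Ens (Quot (collapse_rel n A))) (f : R -> Quot (collapse_rel n A)) c d x y,
    OY W -> continuous R_top OY f -> c <= d -> (forall t, c <= t <= d -> W (f t)) ->
    p x = f c -> p y = f d -> Joined 0 1 (fun _ => W) x y.

Lemma local_joining_of_lpc : locally_path_connected OX -> local_joining.
Proof.
  intros Hlpc W f c d x y HW Cf Hcd Wf Hx Hy.
  destruct (Rle_lt_or_eq_dec c d Hcd) as [Hlt|<-];
    [|apply joined_fibre; [congruence|rewrite Hx; apply Wf; lra]].
  (* Openness is checked upstairs: from [z], a point [v] is reached through its fibre, then all of a
     path connected neighbourhood of [v] lying over [W]. *)
  assert (Hopen : forall z, OY (fun q => W q /\ exists u, p u = q /\ Joined 0 1 (fun _ => W) z u)).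
  { intro z; apply (open_of_nbhds OX HX); fold p; intros v (Wv & u & Eu & Ju).
    destruct (Hlpc v _ HW Wv) as (V & HV & Vv & HVW & HVp).
    exists V; split; auto; split; auto; intros v' Vv'; split; [now apply HVW|].
    exists v'; split; auto; apply joined_trans01 with u; auto.
    apply joined_trans01 with v; [apply joined_fibre; auto; now rewrite Eu|].
    now apply (joined_of_path_connected V). }
  revert x y Hx Hy.
  apply (cousin (fun a b => forall x y, p x = f a -> p y = f b -> Joined 0 1 (fun _ => W) x y));
    auto.
  - intros a b e _ _ H1 H2 x y Hx Hy; destruct (qmap_surj _ (f b)) as (z & Hz).
    apply joined_trans01 with z; auto.
  (* Near [s] the path stays in the open class of a lift [z] of [f s], so both ends are joined
     through [z]. *)
  - intros s Hs; destruct (qmap_surj _ (f s)) as (z & Hz); fold p in Hz.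
    destruct (Cf _ (Hopen z) s) as (e & He & H).
    { split; [now apply Wf|]; exists z; split; auto; apply joined_refl.
      rewrite Hz; now apply Wf. }
    assert (H' : forall t u, Rabs (t - s) < e -> p u = f t -> Joined 0 1 (fun _ => W) z u).
    { intros t u Ht Hu; destruct (H t Ht) as (Wt & v & Hv & Jv).
      apply joined_trans01 with v; auto; apply joined_fibre; congruence. }
    exists e; split; auto; intros a b Ha Has Hsb Hb Hab Hea Heb x y Hx Hy.
    apply joined_trans01 with z.
    + apply joined_rev; [lra|]; apply (H' a); auto; apply Rabs_def1; lra.
    + apply (H' b); auto; apply Rabs_def1; lra.
Qed.

(** A point of the saturation of [V] lies in [V] or in some [A i]; in the latter case that whole
    open set lies in the saturation. *)
Lemma p_open (Hop : forall i, (i < n)%nat -> OX (A i)) (V : Ens X) :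
  OX V -> OY (fun q => exists x, V x /\ p x = q).
Proof.
  intro HV; apply (open_of_nbhds OX HX); fold p; intros z (x & Vx & E).
  destruct (collapse_cases x z E) as [->|[_ (i & Hi & Az)]].
  - exists V; split; auto; split; auto; intros y Vy; eauto.
  - exists (A i); split; auto; split; auto; intros y Ay; exists x; split; auto.
    rewrite E; now apply (collapse_in i).
Qed.

(** Away from the collapsed points [p] is injective and open, so any set-theoretic section [sec]
    lifts the path continuously. *)
Lemma lift_off_collapsed (Hop : forall i, (i < n)%nat -> OX (A i))
  (W : Ens (Quot (collapse_rel n A))) (f : R -> Quot (collapse_rel n A)) c d x y :
  continuous R_top OY f -> c <= d -> (forall t, c <= t <= d -> W (f t)) ->
  (forall t, c <= t <= d -> forall i z, (i < n)%nat -> A i z -> p z <> f t) ->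
  p x = f c -> p y = f d -> Joined 0 1 (fun _ => W) x y.
Proof.
  intros Cf Hcd Wf Hno Hx Hy.
  destruct (Rle_lt_or_eq_dec c d Hcd) as [Hlt|<-];
    [|apply joined_fibre; [congruence|rewrite Hx; apply Wf; lra]].
  destruct (functional_choice _ (qmap_surj (collapse_rel n A))) as (sec & Hsec); fold p in Hsec.
  (* Retraction of [R] onto [c, d]: [f (k t)] avoids the collapsed points at every real time. *)
  set (k := fun t => Rmax c (Rmin t d)).
  assert (Hk : forall t, c <= k t <= d).
  { intro t; unfold k, Rmax, Rmin; repeat destruct Rle_dec; lra. }
  assert (kc : k c = c) by (unfold k, Rmax, Rmin; repeat destruct Rle_dec; lra).
  assert (kd : k d = d) by (unfold k, Rmax, Rmin; repeat destruct Rle_dec; lra).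
  assert (Cfk : continuous R_top OY (fun t => f (k t))).
  { apply (continuous_comp R_top R_top); auto; apply cont_of_cont2; unfold k; cont2. }
  assert (J : Joined 0 1 (fun _ => W) (sec (f (k c))) (sec (f (k d)))).
  { apply joined_rescale with c d; [auto|lra|].
    apply (joined_path c d (fun _ => W) (fun t => sec (f (k t)))).
    - intros V HV t Vt.
      destruct (Cfk _ (p_open Hop V HV) t) as (e & He & H); [eauto|].
      (* A point of [V] over [f (k t')] is the lift itself, since that fibre contains no point of
         the [A i]. *)
      exists e; split; auto; intros t' Ht'; destruct (H t' Ht') as (z & Vz & Ez).
      destruct (collapse_cases z (sec (f (k t')))) as [<-|[(i & Hi & Az) _]]; auto.
      + now rewrite Hsec.
      + exfalso; apply (Hno (k t') (Hk t') i z); auto.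
    - intros t _; rewrite Hsec; apply Wf, Hk. }
  rewrite kc, kd in J.
  apply joined_trans01 with (sec (f c)).
  - apply joined_fibre; [now rewrite Hsec|rewrite Hx; apply Wf; lra].
  - apply joined_trans01 with (sec (f d)); auto.
    apply joined_fibre; [now rewrite Hsec|rewrite Hsec; apply Wf; lra].
Qed.

(* Induction on the number [k] of sets whose image the path may meet: between its
   first and last visits to the [k]-th point the path is replaced by a constant one. *)
Lemma local_joining_step (Hop : forall i, (i < n)%nat -> OX (A i)) (k : nat) :
  (k <= n)%nat ->
  forall (W : Ens (Quot (collapse_rel n A))) (f : R -> Quot (collapse_rel n A)) c d x y,
    OY W -> continuous R_top OY f -> c <= d -> (forall t, c <= t <= d -> W (f t)) ->
    (forall t, c <= t <= d -> forall i z, (k <= i < n)%nat -> A i z -> p z <> f t) ->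
    p x = f c -> p y = f d -> Joined 0 1 (fun _ => W) x y.
Proof.
  induction k as [|k IH]; intros Hkn W f c d x y HW Cf Hcd Wf Hno Hx Hy.
  { apply (lift_off_collapsed Hop W f c d); auto.
    intros t Ht i z Hi; apply Hno; auto; lia. }
  (* One side of a visit: the path ends at a time when it is at the [k]-th point. The other side is
     obtained by reversing time. *)
  assert (half : forall g c d x v, continuous R_top OY g -> c <= d ->
    (forall t, c <= t <= d -> W (g t)) ->
    (forall t, c <= t <= d -> forall i z, (S k <= i < n)%nat -> A i z -> p z <> g t) ->
    p x = g c -> A k v -> p v = g d -> Joined 0 1 (fun _ => W) x v).
  { clear f c d x y Cf Hcd Wf Hno Hx Hy; intros f c d x v Cf Hcd Wf Hno Hx Av Hv.
    set (star := fun q => exists w, A k w /\ p w = q).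
    (* [s] is the infimum of the visiting times, obtained as the supremum of the ends of visit-free
       initial segments. *)
    destruct (completeness (fun r => c <= r <= d /\ forall t, c <= t < r -> ~ star (f t)))
      as (s & Hub & Hlub).
    { exists d; intros r [Hr _]; lra. }
    { exists c; split; [lra|]; intros; lra. }
    assert (Hs : c <= s <= d).
    { split; [apply Hub; split; [lra|intros; lra]|apply Hlub; intros r [Hr _]; lra]. }
    assert (Hbefore : forall t, c <= t < s -> ~ star (f t)).
    { intros t Ht St; enough (s <= t) by lra; apply Hlub; intros r [Hr Hr'].
      apply Rnot_lt_le; intro; apply (Hr' t); auto; lra. }
    assert (Hafter : forall e, 0 < e -> exists t, s <= t <= d /\ t < s + e /\ star (f t)).
    { intros e He; apply NNPP; intro Hn.
      set (r := Rmin d (s + e / 2)).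
      assert (Hr1 : r <= d) by apply Rmin_l.
      assert (Hr2 : r <= s + e / 2) by apply Rmin_r.
      assert (Hr3 : s <= r) by (apply Rmin_glb; lra).
      assert (Hr : r <= s).
      { apply Hub; split; [lra|]; intros t Ht St.
        destruct (Rlt_le_dec t s) as [|]; [apply (Hbefore t); auto; lra|].
        apply Hn; exists t; repeat split; auto; lra. }
      assert (Er : r = d \/ r = s + e / 2) by (unfold r, Rmin; destruct Rle_dec; auto).
      destruct Er as [Er|]; [|lra].
      apply Hn; exists d; repeat split; try lra; exists v; auto. }
    destruct (qmap_surj _ (f s)) as (z & Hz); fold p in Hz.
    assert (Wz : W (p z)) by (rewrite Hz; now apply Wf).
    assert (Wv : W (p v)) by (rewrite Hv; apply Wf; lra).
    apply joined_trans01 with z.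
    - destruct (Rle_lt_or_eq_dec c s (proj1 Hs)) as [Hcs|<-];
        [|apply joined_fibre; [congruence|rewrite Hx; apply Wf; lra]].
      apply (IH ltac:(lia) W f c s); auto; [lra|intros; apply Wf; lra|].
      intros t Ht i w Hi Aw E.
      destruct (Nat.eq_dec i k) as [->|]; [|apply (Hno t ltac:(lra) i w); auto; lia].
      destruct (Rle_lt_or_eq_dec t s (proj2 Ht)) as [Hts| ->].
      + apply (Hbefore t); [lra|]; exists w; auto.
      (* [star] is open, so a visit at [s > c] would force visits shortly before [s]. *)
      + destruct (Cf star (p_open Hop (A k) (Hop k Hkn)) s) as (e & He & H);
          [exists w; auto|].
        pose proof (Rmax_l c (s - e / 2)); pose proof (Rmax_r c (s - e / 2)).
        assert (Rmax c (s - e / 2) < s) by (apply Rmax_lub_lt; lra).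
        apply (Hbefore (Rmax c (s - e / 2))); [lra|]; apply H, Rabs_def1; lra.
    (* Visits occur at or arbitrarily soon after [s] and [p] is open, so every neighbourhood of [z]
       meets the fibre of [p v], which lies in the [A j]; hence [z] is in the closure of one [A j]
       meeting that fibre. *)
    - destruct (closure_finite_union OX HX A (fun j => exists w, A j w /\ p w = p v) z n)
        as (j & Hj & (w & Aw & Ew) & Hzj).
      + intros V HV Vz.
        destruct (Cf _ (p_open Hop V HV) s) as (e & He & H); [exists z; auto|].
        destruct (Hafter e He) as (t & Ht & Hte & w & Aw & Ew).
        destruct (H t) as (y & Vy & Ey); [apply Rabs_def1; lra|].
        assert (Ev : p w = p v) by (now apply (collapse_in k)).
        destruct (collapse_cases y w) as [->|[(j & Hj & Ay) _]]; [congruence| |].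
        * exists k, w; repeat split; eauto.
        * exists j, y; repeat split; auto; exists y; split; auto; congruence.
      + apply joined_trans01 with w; [apply (joined_closure j); auto; congruence|].
        apply joined_fibre; congruence. }
  destruct (classic (exists t w, c <= t <= d /\ A k w /\ p w = f t))
    as [(t & w & Ht & Aw & Ew)|Hn].
  - apply joined_trans01 with w.
    + apply (half f c t); auto; [lra| |]; intros u Hu; [apply Wf | apply Hno]; lra.
    + apply joined_rev; [lra|].
      apply (half (fun u => f (- u)) (- d) (- t)); auto.
      * apply (continuous_comp R_top R_top); auto; apply cont_of_cont2.
        intros V HV u s Vu; destruct (HV (- u) Vu) as (e & He & H); exists e; split; auto.
        intros u' s' Hu _; apply H; replace (- u' - - u) with (- (u' - u)) by lra.
        now rewrite Rabs_Ropp.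
      * lra.
      * intros u Hu; apply Wf; lra.
      * intros u Hu; apply Hno; lra.
      * now rewrite Ropp_involutive.
      * now rewrite Ropp_involutive.
  - apply (IH ltac:(lia) W f c d); auto.
    intros t Ht i z Hi Az E; destruct (Nat.eq_dec i k) as [->|].
    + apply Hn; eauto.
    + apply (Hno t Ht i z); auto; lia.
Qed.

Lemma local_joining_of_open : (forall i, (i < n)%nat -> OX (A i)) -> local_joining.
Proof.
  intros Hop W f c d x y HW Cf Hcd Wf Hx Hy.
  apply (local_joining_step Hop n (le_n n) W f c d); auto.
  intros; lia.
Qed.

(** * The projection has dense image on pi1 *)

Definition push {a : X} (f : Loop OX a) : Loop OY (p a) :=
  exist _ (fun t => p (proj1_sig f t))
    (conj (continuous_comp I_top OX OY _ p (proj1 (proj2_sig f)) p_continuous)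
      (conj (f_equal p (proj1 (proj2 (proj2_sig f))))
        (f_equal p (proj2 (proj2 (proj2_sig f)))))).

Lemma push_continuous (a : X) :
  continuous (loop_top OX a) (loop_top OY (p a)) push.
Proof.
  apply continuous_generated; [apply generated_topology|].
  intros V (K & U & HK & HU & E); apply generated_open.
  exists K, (fun x => U (p x)); exact (conj HK (conj HU (fun f => E (push f)))).
Qed.

Lemma push_homotopic (a : X) (f g : Loop OX a) :
  loop_homotopic OX a f g -> loop_homotopic OY (p a) (push f) (push g).
Proof.
  intros (H & CH & Hf & Hg & H0 & H1); exists (fun q => p (H q)).
  split; [exact (continuous_comp _ OX OY _ p CH p_continuous)|].
  repeat split; intros; apply (f_equal p); auto.
Qed.

Definition pi1_map (a : X) : pi1 OX a -> pi1 OY (p a) :=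
  qlift (fun f => qmap (loop_homotopic OY (p a)) (push f)).

Lemma pi1_map_compat (a : X) (f g : Loop OX a) : loop_homotopic OX a f g ->
  qmap (loop_homotopic OY (p a)) (push f) = qmap (loop_homotopic OY (p a)) (push g).
Proof. intro H; apply (qmap_eq _ loop_homotopic_equiv); now apply push_homotopic. Qed.

Lemma pi1_map_continuous (a : X) :
  continuous (pi1_top OX a) (pi1_top OY (p a)) (pi1_map a).
Proof.
  apply (qlift_continuous _ loop_homotopic_equiv); [apply pi1_map_compat|].
  intros V HV; apply (push_continuous a _ HV).
Qed.

Lemma loops_approximated (Hloc : local_joining) (a : X) (W : Ens (Loop OY (p a)))
  (f : Loop OY (p a)) : loop_top OY (p a) W -> W f ->
  exists g h, W h /\ loop_homotopic OY (p a) (push g) h.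
Proof.
  intros HW Wf; destruct (loop_top_basis OY (p a) W f HW Wf) as (l & Hl & HlW).
  (* The constraints that the basic neighbourhood of [f] imposes at time [t]. *)
  set (U := fun t q => forall b, In b l -> fst b (clamp t) -> snd b q).
  assert (J : Joined 0 1 U a a).
  (* Quantifying over all lifts of the end points lets pieces be glued at an arbitrary lift of the
     intermediate point. *)
  { assert (J : forall x y, p x = lp f 0 -> p y = lp f 1 -> Joined 0 1 U x y);
      [|apply J; [now rewrite lp_le0 by lra|now rewrite lp_ge1 by lra]].
    apply (cousin (fun c d => forall x y, p x = lp f c -> p y = lp f d -> Joined c d U x y)).
    - lra.
    - intros c m d Hcm Hmd H1 H2 x y Hx Hy; destruct (qmap_surj _ (lp f m)) as (z & Hz).
      apply joined_trans with m z; auto.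
    - intros s Hs.
      destruct (loop_basis_local OY collapse_topology (p a) f l s Hl)
        as (e & V & He & HV & H1 & H2).
      exists e; split; auto; intros c d _ Hcs Hsd _ Hcd Hec Hed x y Hx Hy.
      apply joined_mono with (fun _ => V).
      + intros t Ht q Vq b; revert b; apply (H2 t); auto; apply Rabs_def1; lra.
      + apply joined_rescale with 0 1; [lra|auto|].
        apply (Hloc V (lp f) c d); auto using lp_continuous; [lra|].
        intros t Ht; apply H1, Rabs_def1; lra. }
  destruct J as (g & H & Cg & CH & g0 & g1 & Hg & H0 & H1 & HU).
  (* The start of the deformation is the projected loop; its end at [s = 1] satisfies all the
     constraints. *)
  exists (mkloop g Cg g0 g1), (mkloop (fun t => H t 1) (cont2_slice OY H 1 CH) (H0 1) (H1 1)).
  split.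
  - apply HlW; intros b Hb t Kt; simpl; apply (HU _ (proj2_sig t) b Hb).
    now rewrite clamp_proj.
  - apply (loop_homotopic_intro _ _ H); auto.
    + intros t Ht; rewrite Hg; unfold lp; simpl; now rewrite cl_id.
    + intros t Ht; now rewrite lp_mkloop.
Qed.

Lemma pi1_map_dense (Hloc : local_joining) (a : X) (V : Ens (pi1 OY (p a))) :
  pi1_top OY (p a) V -> (exists z, V z) -> exists w, V (pi1_map a w).
Proof.
  intros HV (z & Vz); destruct (qmap_surj _ z) as (f & <-).
  destruct (loops_approximated Hloc a _ f HV Vz) as (g & h & Vh & Hgh).
  exists (qmap _ g); unfold pi1_map.
  rewrite (qlift_qmap _ loop_homotopic_equiv _ (pi1_map_compat a)).
  replace (qmap (loop_homotopic OY (p a)) (push g)) with (qmap (loop_homotopic OY (p a)) h);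
    auto.
  apply (qmap_eq _ loop_homotopic_equiv).
  now apply (proj1 (proj2 loop_homotopic_equiv)).
Qed.

End Collapse.

(** * Discreteness of a countable fundamental group of the quotient *)

Theorem theorem4p5 (X : Type) (OX : topology X) (HX : is_topology OX)
  (n : nat) (A : nat -> Ens X) (Hstar : cond_star OX n A)
  (a : X) (Ha : exists i, (i < n)%nat /\ A i a)
  (Hcpt : compact_space (pi1_top OX a))
  (Hhaus : hausdorff (pi1_top (collapse_top OX n A) (qmap (collapse_rel n A) a))) :
  discrete (pi1_top (collapse_top OX n A) (qmap (collapse_rel n A) a)) \/
  uncountable (pi1 (collapse_top OX n A) (qmap (collapse_rel n A) a)).
Proof.
  destruct (classic (uncountable (pi1 (collapse_top OX n A) (qmap (collapse_rel n A) a))))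
    as [|Hc]; auto; left.
  apply NNPP in Hc as (f & Hf).
  assert (Hcl : forall i, (i < n)%nat -> path_connected_set OX (closure OX (A i))).
  { destruct Hstar as [(_ & H)|(_ & _ & _ & H & _)]; intros i Hi; apply (H i Hi). }
  assert (Hloc : local_joining OX n A).
  { destruct Hstar as [(_ & H)|(_ & Hlpc & _)].
    - apply local_joining_of_open; auto; intros i Hi; apply (H i Hi).
    - now apply local_joining_of_lpc. }
  pose proof (compact_dense_image_surj _ _ pi1_topology (pi1_map OX n A a)
    (pi1_map_continuous OX n A a) Hcpt Hhaus (pi1_map_dense OX HX n A Hloc a)) as Hsurj.
  pose proof (compact_image _ _ _ (pi1_map_continuous OX n A a) Hsurj Hcpt) as Hcpt'.
  (* The class of the constant loop provides the point that the Baire argument requires. *)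
  destruct (countable_compact_hausdorff_isolated _ pi1_topology Hcpt' Hhaus f Hf
    (qmap _ lconst)) as (z & Hz).
  exact (pi1_discrete_of_isolated z Hz).
Qed.
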